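(* Assume (RHS.1), (RHS.2b) (i.e., $f\equiv0$), (BC.1), (BC.2), that condition (M.1) holds for the discretization parameters in use, and that there is $\alpha\in(0,1]$ with $g\in C^{0,\alpha}(\partial\Omega)$ and such that the viscosity solution $u$ of $-\Delta^\diamond_\infty u=0$ in $\Omega$, $u=g$ on $\partial\Omega$ satisfies $u\in C^{0,\alpha}(\overline\Omega)$. Let $u_{\mathfrak h}$ be the solution of the discrete problem. If $\mathfrak h=(h,\varepsilon,\theta)$ is sufficiently small, $\varepsilon-\varepsilon\theta-h>0$, and $(2h+\varepsilon\theta)/\varepsilon^2$ is sufficiently small, then $$\|u-u_{\mathfrak h}\|_{L^\infty(\Omega_h)}\le C\Big(\varepsilon^\alpha+\frac{\sqrt{2h+\varepsilon\theta}}{\varepsilon}\Big),$$ where $C$ depends only on $d$, $\Omega$, the shape regularity of the family of meshes, and the $C^{0,\alpha}$ norms of $g$ and $u$.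
   Context: Setting: $\Omega\subset\mathbb R^d$ ($d\ge1$) is a bounded domain with continuous boundary. For $r>0$, $\Omega^{(r)}=\{x\in\Omega:\operatorname{dist}(x,\partial\Omega)>r\}$. $\{\mathcal T_h\}_{h>0}$ is a quasiuniform family of meshes of closed simplices, $h=\max_T\operatorname{diam}T$, $\Omega_h$ the interior of the union of the simplices, with $\Omega^{(h)}\subset\Omega_h\subset\Omega$; $\mathcal N_h$ is the set of vertices. $\mathbb V_h$ is the space of continuous piecewise linear functions on $\mathcal T_h$, with hat basis $\{\hat\varphi_z\}_{z\in\mathcal N_h}$, and $\mathcal I_h$ is the Lagrange interpolant. Parameters $\mathfrak h=(h,\varepsilon,\theta)$ with $\varepsilon\in[h,\operatorname{diam}\Omega]$, $0<\theta\le1$. Interior nodes $\mathcal N_h^I=\mathcal N_h\cap\Omega^{(2\varepsilon)}$; boundary nodes $\mathcal N_h^b=\mathcal N_h\setminus\mathcal N_h^I$. $\mathbb S_\theta$ is a finite symmetric subset of the unit sphere $\mathbb S$ such that each $v\in\mathbb S$ has $v_\theta\in\mathbb S_\theta$ with $|v-v_\theta|\le\theta$. For $z\in\mathcal N_h^I$, $\mathcal N_{\mathfrak h}(z)=\{z\}\cup\{z+\varepsilon v_\theta:v_\theta\in\mathbb S_\theta\}$, and for $w\in C(\overline\Omega)$, $-\Delta^\diamond_{\infty,\mathfrak h}w(z)=\varepsilon^{-2}\big(2w(z)-\max_{x\in\mathcal N_{\mathfrak h}(z)}\mathcal I_hw(x)-\min_{x\in\mathcal N_{\mathfrak h}(z)}\mathcal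 I_hw(x)\big)$. Also $\widetilde{\mathcal N}_{\mathfrak h}(z)=\{z\}\cup\{z'\in\mathcal N_h:\exists v_\theta\in\mathbb S_\theta,\ \hat\varphi_{z'}(z+\varepsilon v_\theta)>0\}$. Assumptions: (RHS.1) $f\in C(\Omega)\cap L^\infty(\Omega)$. (RHS.2b) $f\equiv0$. (BC.1) $g\in C(\partial\Omega)$. (BC.2) for every $\varepsilon>0$ a function $\tilde g_\varepsilon\in C(\overline\Omega)$ is given such that, if $g\in C^{0,\alpha}(\partial\Omega)$ for some $\alpha\in[0,1]$, then $\tilde g_\varepsilon\in C^{0,\alpha}(\overline\Omega)$ and $\|g-\tilde g_\varepsilon\|_{L^\infty(\partial\Omega)}\le C\varepsilon^\alpha$. (M.1): for every nonempty $S\subset\mathcal N_h^I$ there are $z\in S$ and $z'\in\mathcal N_h\setminus S$ with $z'\in\widetilde{\mathcal N}_{\mathfrak h}(z)$. Discrete problem: find $u_{\mathfrak h}\in\mathbb V_h$ with $-\Delta^\diamond_{\infty,\mathfrak h}u_{\mathfrak h}(z)=f(z)$, $z\in\mathcal N_h^I$, and $u_{\mathfrak h}(z)=\tilde g_\varepsilon(z)$, $z\in\mathcal N_h^b$. Continuous problem: $\Delta^\diamond_\infty\varphi=|D\varphi|^{-2}D\varphi^\intercal D^2\varphi D\varphi$ where $D\varphi\ne0$; $\Delta^\pm_\infty\varphi(x)$ equal this if $D\varphi(x)\ne0$ and $\lambda_{\max}$, resp. $\lambda_{\min}$, of $D^2\varphi(x)$ if $D\varphi(x)=0$. The viscosity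 solution $u\in C(\overline\Omega)$ satisfies $u=g$ on $\partial\Omega$ and, for all $x_0\in\Omega$, $\varphi\in C^2$: $u-\varphi$ local max at $x_0$ implies $-\Delta^+_\infty\varphi(x_0)\le f(x_0)$; $u-\varphi$ local min at $x_0$ implies $-\Delta^-_\infty\varphi(x_0)\ge f(x_0)$. It exists and is unique.
   Formalization: In (BC.2) the C^{0,α} norms of g̃_ε are assumed bounded uniformly in ε, and C may also depend on that bound and on the constant in ‖g−g̃_ε‖≤Cε^α; without this the claim fails, e.g. for g=u=0 and g̃_ε=min(1,dist(x,∂Ω)/ε). *)

(* Defs.v *)
From HB Require Import structures.
From mathcomp Require Import all_boot all_order all_algebra.
From mathcomp Require Import all_classical all_reals all_analysis.
Set Implicit Arguments. Unset Strict Implicit. Unset Printing Implicit Defensive.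
Import Order.TTheory GRing.Theory Num.Theory.
Import numFieldNormedType.Exports.
Local Open Scope classical_set_scope.
Local Open Scope ring_scope.

Section Defs.
Variables (R : realType) (d : nat).
Notation pt := 'rV[R]_d.

Definition dotp (u v : pt) : R := \sum_(i < d) u 0 i * v 0 i.
Definition enorm (v : pt) : R := Num.sqrt (dotp v v).

Definition bdry (O : set pt) : set pt := closure O `\` O.
Definition dist_bd (O : set pt) (x : pt) : R :=
  inf [set enorm (x - y) | y in bdry O].
Definition layer (O : set pt) (r : R) : set pt :=
  [set x | O x /\ dist_bd O x > r].
Definition diam_set (O : set pt) : R :=
  sup [set enorm (x - y) | x in O & y in O].

(* bounded domain (open, connected, bounded, nonempty) with continuous boundary:
   near every boundary point, in a rotated frame with "vertical" unit direction
   nu, Omega is the strict epigraph of a continuous function of the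
   orthogonal projection onto nu^perp. *)
Definition bounded_domain (O : set pt) : Prop :=
  open O /\ connected O /\ O !=set0 /\ exists K : R, forall x, O x -> enorm x <= K.
Definition continuous_boundary (O : set pt) : Prop :=
  forall x0, bdry O x0 ->
  exists (nu : pt) (r : R) (gam : pt -> R),
    [/\ enorm nu = 1, 0 < r, continuous gam &
     forall x, enorm (x - x0) < r ->
       (O x <-> dotp (x - x0) nu > gam ((x - x0) - dotp (x - x0) nu *: nu))].

Definition holder_bound (A : set pt) (alpha K : R) (v : pt -> R) : Prop :=
  (forall x, A x -> `|v x| <= K) /\
  (forall x y, A x -> A y -> `|v x - v y| <= K * powR (enorm (x - y)) alpha).

Definition evec (i : 'I_d) : pt := delta_mx 0 i.
Definition pderiv (i : 'I_d) (phi : pt -> R) : pt -> R :=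
  fun x => 'D_(evec i) phi x.
Definition C2 (phi : pt -> R) : Prop :=
  [/\ continuous phi,
      forall i x, derivable phi x (evec i),
      forall i, continuous (pderiv i phi),
      forall i j x, derivable (pderiv i phi) x (evec j) &
      forall i j, continuous (pderiv j (pderiv i phi))].
Definition grad (phi : pt -> R) (x : pt) : pt := \row_i pderiv i phi x.
Definition hess (phi : pt -> R) (x : pt) : 'M[R]_d :=
  \matrix_(i, j) pderiv j (pderiv i phi) x.
Definition lambda_max (A : 'M[R]_d) : R := sup [set a : R | eigenvalue A a].
Definition lambda_min (A : 'M[R]_d) : R := inf [set a : R | eigenvalue A a].
Definition inflap (phi : pt -> R) (x : pt) : R :=
  ((grad phi x *m hess phi x *m (grad phi x)^T) 0 0) / (enorm (grad phi x)) ^+ 2.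
Definition inflap_plus (phi : pt -> R) (x : pt) : R :=
  if grad phi x != 0 then inflap phi x else lambda_max (hess phi x).
Definition inflap_minus (phi : pt -> R) (x : pt) : R :=
  if grad phi x != 0 then inflap phi x else lambda_min (hess phi x).

Definition loc_max_in (O : set pt) (w : pt -> R) (x0 : pt) : Prop :=
  exists2 r : R, 0 < r & forall x, O x -> enorm (x - x0) < r -> w x <= w x0.
Definition loc_min_in (O : set pt) (w : pt -> R) (x0 : pt) : Prop :=
  exists2 r : R, 0 < r & forall x, O x -> enorm (x - x0) < r -> w x0 <= w x.

Definition visc_sol (O : set pt) (f g u : pt -> R) : Prop :=
  [/\ {within closure O, continuous u},
      (forall x, bdry O x -> u x = g x) &
      forall x0 (phi : pt -> R), O x0 -> C2 phi ->
        (loc_max_in O (fun x => u x - phi x) x0 -> - inflap_plus phi x0 <= f x0) /\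
        (loc_min_in O (fun x => u x - phi x) x0 -> - inflap_minus phi x0 >= f x0)].

Local Notation simplex := {ffun 'I_d.+1 -> pt}.
Local Notation mesh := (seq simplex).

Definition comb (T : simplex) (lam : 'rV[R]_d.+1) : pt := \sum_(i < d.+1) lam 0 i *: T i.
Definition simplex_set (T : simplex) : set pt :=
  [set x | exists lam : 'rV[R]_d.+1,
     [/\ forall i, 0 <= lam 0 i, \sum_i lam 0 i = 1 & x = comb T lam]].
Definition common_face (T T' : simplex) : set pt :=
  [set x | exists lam : 'rV[R]_d.+1,
     [/\ forall i, 0 <= lam 0 i, \sum_i lam 0 i = 1,
         forall i, T i \notin codom (fun k => T' k) -> lam 0 i = 0 & x = comb T lam]].
Definition edge_mx (T : simplex) : 'M[R]_d := \matrix_(i < d) (T (lift ord0 i) - T ord0).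
Definition diam_simplex (T : simplex) : R :=
  \big[Num.max/0]_(i < d.+1) \big[Num.max/0]_(j < d.+1) enorm (T i - T j).
Definition meshsize (M : mesh) : R := \big[Num.max/0]_(T <- M) diam_simplex T.

Definition valid_mesh (M : mesh) : Prop :=
  M != [::] /\
  (forall T, T \in M -> \det (edge_mx T) != 0) /\
  (forall T T', T \in M -> T' \in M -> simplex_set T `&` simplex_set T' = common_face T T').
(* quasi-uniformity with constant sig: every simplex has volume comparable to h^d *)
Definition quasiuniform (sig : R) (M : mesh) : Prop :=
  forall T, T \in M -> meshsize M ^+ d <= sig * `|\det (edge_mx T)|.

Definition mesh_union (M : mesh) : set pt := [set x | exists2 T, T \in M & simplex_set T x].
Definition Omega_h (M : mesh) : set pt := interior (mesh_union M).
Definition nodes (M : mesh) : seq pt := undup (flatten (map (fun T : {ffun 'I_d.+1 -> pt} => codom (fun k => T k)) M)).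

Definition bary (T : simplex) (x : pt) : 'rV[R]_d.+1 :=
  xget 0 [set lam : 'rV[R]_d.+1 | \sum_i lam 0 i = 1 /\ x = comb T lam].
Definition bary_at (T : simplex) (x z : pt) : R :=
  \sum_(i < d.+1 | T i == z) bary T x 0 i.
Definition hat (M : mesh) (z : pt) (x : pt) : R :=
  xget 0 [set c : R | exists2 T, T \in M & simplex_set T x /\ c = bary_at T x z].
Definition interp (M : mesh) (w : pt -> R) : pt -> R :=
  fun x => \sum_(z <- nodes M) w z * hat M z x.
(* membership in V_h : continuous piecewise linear = its own interpolant on the mesh *)
Definition in_Vh (M : mesh) (v : pt -> R) : Prop :=
  forall x, mesh_union M x -> v x = interp M v x.

Definition sphere_net (theta : R) (S : seq pt) : Prop :=
  [/\ forall v, v \in S -> enorm v = 1,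
      forall v, v \in S -> - v \in S &
      forall v, enorm v = 1 -> exists2 w, w \in S & enorm (v - w) <= theta].

Definition interior_node (O : set pt) (M : mesh) (eps : R) (z : pt) : Prop :=
  z \in nodes M /\ layer O (2 * eps) z.

Definition dmax (M : mesh) (eps : R) (S : seq pt) (w : pt -> R) (z : pt) : R :=
  \big[Num.max/interp M w z]_(v <- S) interp M w (z + eps *: v).
Definition dmin (M : mesh) (eps : R) (S : seq pt) (w : pt -> R) (z : pt) : R :=
  \big[Num.min/interp M w z]_(v <- S) interp M w (z + eps *: v).
Definition neg_dinflap (M : mesh) (eps : R) (S : seq pt) (w : pt -> R) (z : pt) : R :=
  eps ^- 2 * (2 * w z - dmax M eps S w z - dmin M eps S w z).

Definition ext_nbhd (M : mesh) (eps : R) (S : seq pt) (z z' : pt) : Prop :=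
  z' = z \/ (z' \in nodes M /\ exists2 v, v \in S & hat M z' (z + eps *: v) > 0).

Definition cond_M1 (O : set pt) (M : mesh) (eps : R) (S : seq pt) : Prop :=
  forall A : set pt, A `<=` interior_node O M eps -> A !=set0 ->
    exists z z', [/\ A z, z' \in nodes M, ~ A z' & ext_nbhd M eps S z z'].

Definition discrete_sol (O : set pt) (M : mesh) (eps : R) (S : seq pt)
    (gt uh : pt -> R) : Prop :=
  [/\ in_Vh M uh,
      forall z, interior_node O M eps z -> neg_dinflap M eps S uh z = 0 &
      forall z, z \in nodes M -> ~ interior_node O M eps z -> uh z = gt z].

End Defs.

Notation mesh R d := (seq {ffun 'I_d.+1 -> 'rV[R]_d}).

(* Main.v *)
Require Import Defs.
From HB Require Import structures.
From mathcomp Require Import all_boot all_order all_algebra.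
From mathcomp Require Import all_classical all_reals all_analysis.
From mathcomp Require Import ring lra.
Import Order.TTheory GRing.Theory Num.Theory.
Import numFieldNormedType.Exports.
Local Open Scope classical_set_scope.
Local Open Scope ring_scope.

(** An infinity harmonic [u] enjoys comparison with cones from above, so that
    [v x = sup_{B_s(x)} u] satisfies [2 v <= sup_{B_s} v + inf_{B_s} v] away
    from the boundary (Armstrong and Smart).  Where the increments of [v] over
    a step are less than [gam s], [v] is replaced by the supremum, over chains of
    steps leading out of this region, of the final value minus [gam s] per step;
    the resulting [F] keeps the finite difference inequality, has increments at
    least [gam s], and differs from [v] by [O(gam)].

    With [eta = 2 h + eps theta], let [W] be the supremum of [F] over balls of
    radius [eps + h].  Since [r |-> sup_{B_r(z)} F] is convex, [2 W z] exceeds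
    [max I_h W + min I_h W] over the stencil by at most [O(eta / eps)] times an
    increment of [F] that is itself at least [gam eps].  Composing [W] with
    [t |-> t + gam t ^ 2] yields a strict discrete subsolution as soon as
    [gam ^ 2 eps ^ 2] is a large multiple of [eta], i.e. for [gam] of order
    [sqrt eta / eps]; comparison at a maximum point then bounds [u - u_h].  The
    same argument applied to [- u] and [- u_h] gives the other inequality. *)

(** * Euclidean norm and topology on row vectors *)

Section Euclid.
Set Implicit Arguments. Unset Strict Implicit.
Context {R : realType} {d : nat}.
Implicit Types (x y z v w : 'rV[R]_d) (a b r : R).

Lemma dotpC x y : dotp x y = dotp y x.
Proof. by apply: eq_bigr => i _; rewrite mulrC. Qed.

Lemma dotpDl x y z : dotp (x + y) z = dotp x z + dotp y z.
Proof. by rewrite /dotp -big_split; apply: eq_bigr => i _; rewrite mxE mulrDl. Qed.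

Lemma dotpZl a x y : dotp (a *: x) y = a * dotp x y.
Proof. by rewrite /dotp mulr_sumr; apply: eq_bigr => i _; rewrite mxE mulrA. Qed.

Lemma dotpDr x y z : dotp x (y + z) = dotp x y + dotp x z.
Proof. by rewrite dotpC dotpDl !(dotpC x). Qed.

Lemma dotpZr a x y : dotp x (a *: y) = a * dotp x y.
Proof. by rewrite dotpC dotpZl dotpC. Qed.

Lemma dotp_ge0 x : 0 <= dotp x x.
Proof. by apply: sumr_ge0 => i _; rewrite -expr2 sqr_ge0. Qed.

Lemma dotp_eq0 x : dotp x x = 0 -> x = 0.
Proof.
move=> /eqP; rewrite psumr_eq0 => [/allP h|i _]; last by rewrite -expr2 sqr_ge0.
apply/rowP => i; rewrite mxE; apply/eqP.
by have := h i; rewrite mem_index_enum mulf_eq0 orbb => /(_ isT).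
Qed.

Lemma enorm_ge0 x : 0 <= enorm x.
Proof. exact: sqrtr_ge0. Qed.

Lemma enorm_sqr x : enorm x ^+ 2 = dotp x x.
Proof. by rewrite sqr_sqrtr ?dotp_ge0. Qed.

Lemma enorm0 : enorm (0 : 'rV[R]_d) = 0.
Proof. by rewrite /enorm /dotp big1 ?sqrtr0// => i _; rewrite mxE mul0r. Qed.

Lemma enorm_eq0 x : enorm x = 0 -> x = 0.
Proof. by move=> h; apply: dotp_eq0; rewrite -enorm_sqr h expr0n. Qed.

Lemma enormZ a x : enorm (a *: x) = `|a| * enorm x.
Proof.
by rewrite /enorm dotpZl dotpZr mulrA -expr2 sqrtrM ?sqr_ge0// sqrtr_sqr.
Qed.

Lemma enormN x : enorm (- x) = enorm x.
Proof. by rewrite -scaleN1r enormZ normrN1 mul1r. Qed.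

Lemma enormBC x y : enorm (x - y) = enorm (y - x).
Proof. by rewrite -enormN opprB. Qed.

Lemma dotp_le x y : dotp x y <= enorm x * enorm y.
Proof.
have [x0|x0] := eqVneq (enorm x) 0.
  by rewrite x0 mul0r (enorm_eq0 x0) /dotp big1// => i _; rewrite mxE mul0r.
have := dotp_ge0 (enorm y *: x - enorm x *: y).
rewrite -scaleNr !(dotpDl, dotpDr, dotpZl, dotpZr) (dotpC y x) -!enorm_sqr => h.
have [y0|y0] := eqVneq (enorm y) 0.
  by rewrite y0 mulr0 (enorm_eq0 y0) /dotp big1// => i _; rewrite mxE mulr0.
have xp : 0 < enorm x by rewrite lt_def x0 enorm_ge0.
have yp : 0 < enorm y by rewrite lt_def y0 enorm_ge0.
have : 0 <= 2 * (enorm x * enorm y) * (enorm x * enorm y - dotp x y) by lra.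
by rewrite pmulr_rge0 ?subr_ge0// !mulr_gt0.
Qed.

Lemma enormD x y : enorm (x + y) <= enorm x + enorm y.
Proof.
rewrite -(ler_pXn2r (n := 2)) ?nnegrE ?enorm_ge0 ?addr_ge0 ?enorm_ge0//.
rewrite enorm_sqr !(dotpDl, dotpDr) (dotpC y x) sqrrD !enorm_sqr.
have := dotp_le x y; lra.
Qed.

Lemma enormB_triangle z x y : enorm (x - y) <= enorm (x - z) + enorm (z - y).
Proof. by rewrite (le_trans _ (enormD _ _))// addrA subrK. Qed.

Lemma enormB_abs x y : `|enorm x - enorm y| <= enorm (x - y).
Proof.
rewrite ler_norml; have := enormD (x - y) y; have := enormD (y - x) x.
by rewrite !subrK (enormBC y x); lra.
Qed.

Lemma coord_le_enorm x i : `|x 0 i| <= enorm x.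
Proof.
rewrite -(ler_pXn2r (n := 2)) ?nnegrE ?enorm_ge0// enorm_sqr real_normK ?num_real//.
rewrite /dotp (bigD1 i)//= -expr2 lerDl; apply: sumr_ge0 => j _.
by rewrite -expr2 sqr_ge0.
Qed.

Lemma norm_le_enorm x : `|x| <= enorm x.
Proof.
rewrite /Num.norm /= mx_normrE; apply: bigmax_le; first exact: enorm_ge0.
by move=> [i j] _ /=; rewrite (ord1 i) coord_le_enorm.
Qed.

Lemma coord_le_norm x i : `|x 0 i| <= `|x|.
Proof.
rewrite [leRHS]/Num.norm /= mx_normrE.
by apply: (@le_bigmax _ _ _ _ (fun ij : 'I_1 * 'I_d => `|x ij.1 ij.2|) (0, i)).
Qed.

Lemma enorm_le_norm x : enorm x <= d%:R * `|x|.
Proof.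
rewrite -(ler_pXn2r (n := 2)) ?nnegrE ?enorm_ge0 ?mulr_ge0 ?ler0n//.
rewrite enorm_sqr /dotp (@le_trans _ _ (\sum_(i < d) `|x| ^+ 2))//.
  apply: ler_sum => i _; rewrite -expr2 -(real_normK (num_real (x 0 i))).
  by rewrite ler_pXn2r ?nnegrE// coord_le_norm.
rewrite exprMn sumr_const card_ord -[leLHS]mulr_natl; apply: ler_wpM2r; first exact: sqr_ge0.
by rewrite -natrX ler_nat; case: (d) => // n; rewrite leq_pmulr.
Qed.

(** The ambient topology is that of the maximum norm, comparable to [enorm] with factors 1 and [d].
    Dividing by [d.+1] keeps the radius positive even for [d = 0]. *)
Lemma nbhs_enormP x (A : set 'rV[R]_d) :
  nbhs x A <-> exists2 r : R, 0 < r & forall y, enorm (y - x) < r -> A y.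
Proof.
split=> [/nbhs_normP[r /= r0 h]|[r r0 h]].
  exists r => // y yx; apply: h => /=.
  by rewrite (le_lt_trans (norm_le_enorm _))// enormBC.
apply/(nbhs_normP x A); exists (r / d.+1%:R) => /=; first by rewrite divr_gt0// ltr0n.
move=> y /= xy; apply: h; rewrite enormBC (le_lt_trans (enorm_le_norm _))//.
rewrite (@le_lt_trans _ _ (d.+1%:R * `|x - y|))//.
  by rewrite ler_wpM2r// ler_nat.
by rewrite mulrC -ltr_pdivlMr ?ltr0n.
Qed.

Lemma openP_enorm (O : set 'rV[R]_d) x : open O -> O x ->
  exists2 r : R, 0 < r & forall y, enorm (y - x) < r -> O y.
Proof. by move=> oO Ox; apply/nbhs_enormP/open_nbhs_nbhs. Qed.

Lemma closureP_enorm (A : set 'rV[R]_d) x :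
  closure A x <-> forall r, 0 < r -> exists2 y, A y & enorm (y - x) < r.
Proof.
split=> [h r r0|h B /nbhs_enormP[r r0 hB]].
  have [|y [Ay yr]] := h [set y | enorm (y - x) < r]; last by exists y.
  by apply/nbhs_enormP; exists r.
by have [y Ay /hB By] := h r r0; exists y.
Qed.

Lemma enorm_continuous z : continuous (fun y => enorm (y - z)).
Proof.
move=> x; apply/(@cvgrPdist_lt R R^o _ (nbhs x) _) => e e0.
apply: (proj2 (nbhs_enormP x [set y | _ < e])); exists e => // y yx.
rewrite /=.
rewrite (le_lt_trans (enormB_abs _ _))//.
by rewrite opprB addrA subrK enormBC.
Qed.

Lemma ball_compact z r : compact [set y | enorm (y - z) <= r].
Proof.
apply: bounded_closed_compact; last first.
  apply: (@preimage_closed _ _ (fun y => enorm (y - z)) [set t | t <= r]).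
    by move=> y _; exact: enorm_continuous.
  exact: closed_le.
exists (r + enorm z); split; first exact: num_real.
move=> M rM y /= yz; rewrite (le_trans (norm_le_enorm _))// (le_trans _ (ltW rM))//.
by have := enormD (y - z) z; rewrite subrK; lra.
Qed.

Lemma ball_has_max (f : 'rV[R]_d -> R) z r :
  0 <= r -> {within [set y | enorm (y - z) <= r], continuous f} ->
  exists2 c, enorm (c - z) <= r & forall y, enorm (y - z) <= r -> f y <= f c.
Proof.
move=> r0 cf.
have zz : [set y | enorm (y - z) <= r] z by rewrite /= subrr enorm0.
have [c] := EVT_max_rV (ex_intro _ z zz) (ball_compact (z := z) (r := r)) cf.
rewrite inE /= => cz h; exists c => // y yz; apply: h; by rewrite inE.
Qed.

Lemma segment_enorm x y t : 0 <= t <= 1 ->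
  enorm (x + t *: (y - x) - x) <= enorm (y - x).
Proof.
move=> /andP[t0 t1]; rewrite addrC addKr enormZ ger0_norm//.
by rewrite ler_piMl ?enorm_ge0.
Qed.

(** The infimum of the parameters outside [O] gives a boundary point: openness keeps it out of [O],
    while smaller parameters lie in [O]. *)
Lemma segment_meets_bdry (O : set 'rV[R]_d) x y : open O -> O x -> ~ O y ->
  exists2 p, bdry O p & enorm (p - x) <= enorm (y - x).
Proof.
move=> oO Ox nOy; pose g t := x + t *: (y - x).
pose E : set R := [set t | 0 <= t <= 1 /\ ~ O (g t)].
have g1 : g 1 = y by rewrite /g scale1r addrC subrK.
have E1 : E 1 by split; [rewrite ler01 lexx|rewrite g1].
have lbE : lbound E 0 by move=> t [/andP[]].
have infE t : E t -> inf E <= t by move=> Et; apply: ge_inf => //; exists 0.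
have hE : has_inf E by split; [exists 1|exists 0].
have t0 : 0 <= inf E by apply: lb_le_inf => //; exists 1.
have t1 : inf E <= 1 by exact: infE.
have gE t : g t - g (inf E) = (t - inf E) *: (y - x).
  by rewrite /g opprD addrACA subrr add0r -scalerBl.
have pos : 0 < enorm (y - x).
  rewrite lt_def enorm_ge0 andbT; apply/eqP => /enorm_eq0/subr0_eq yx.
  by apply: nOy; rewrite yx.
exists (g (inf E)); last by apply: segment_enorm; rewrite t0.
have nO : ~ O (g (inf E)).
  move=> /(openP_enorm oO)[r r0 hr].
  have [t Et tr] := inf_adherent (divr_gt0 r0 pos) hE.
  apply: (proj2 Et); apply: hr; rewrite gE enormZ -ltr_pdivlMr// ger0_norm.
    by rewrite ltrBlDl.
  by rewrite subr_ge0; apply: infE.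
split => //; apply/closureP_enorm => r r0.
have tp : 0 < inf E.
  rewrite lt_def t0 andbT; apply/eqP => te; apply: nO.
  by rewrite te /g scale0r addr0.
pose t := Num.max 0 (inf E - r / 2 / enorm (y - x)).
have tlt : t < inf E by rewrite gt_max tp ltrBlDr ltrDl !divr_gt0.
exists (g t).
  apply: contrapT => nOt; have tlt' := tlt; move: tlt; rewrite ltNge => /negP; apply.
  by apply: infE; split=> //; rewrite le_max lexx/= (le_trans (ltW tlt')).
rewrite gE enormZ -ltr_pdivlMr// ltr0_norm ?subr_lt0// opprB ltrBlDr -ltrBlDl.
rewrite lt_max; apply/orP; right; rewrite ltrD2l ltrN2 ltr_pM2r ?invr_gt0//; lra.
Qed.

End Euclid.

(** * Radial polynomial test functions *)

Section RadialTest.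
Context {R : realType} {d : nat}.
Set Implicit Arguments. Unset Strict Implicit.
Implicit Types (x y z v : 'rV[R]_d) (p : {poly R}).

(** Polynomials in the squared distance are smooth at the centre as well, unlike the distance
    itself, and so are admissible global test functions. *)
Definition sqdist z y : R := dotp (y - z) (y - z).

Lemma is_derive_coord z (i j : 'I_d) y :
  is_derive y (evec R j) (fun y => (y - z) 0 i) (i == j)%:R.
Proof.
have -> : (fun y : 'rV[R]_d => (y - z) 0 i) = (fun y => y 0 i - z 0 i).
  by apply/funext => w; rewrite !mxE.
have h : is_derive y (evec R j) (fun y : 'rV[R]_d => y 0 i) (i == j)%:R.
  have /derivable_mxP hd := @derivable_id R 'rV[R]_d y (evec R j).
  apply: DeriveDef; first exact: (hd 0 i).
  have := @derive_mx R 'rV[R]_d 1 d id y (evec R j) (@derivable_id _ _ y (evec R j)).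
  rewrite derive_id => /(congr1 (fun M : 'rV[R]_d => M 0 i)).
  by rewrite !mxE eqxx => <-.
by rewrite -[X in is_derive _ _ _ X]subr0; apply: is_deriveB.
Qed.

Lemma is_derive_sqdist z i y :
  is_derive y (evec R i) (sqdist z) (2 * (y - z) 0 i).
Proof.
pose h (k : 'I_d) (w : 'rV[R]_d) : R := ((w - z) 0 k) * ((w - z) 0 k).
have -> : sqdist z = \sum_(k < d) h k.
  by apply/funext => w; rewrite fct_sumE.
have hk k : is_derive y (evec R i) (h k) (((k == i)%:R * (y - z) 0 k) *+ 2).
  apply: is_derive_eq; first by apply: is_deriveM; exact: is_derive_coord.
  by rewrite /GRing.scale /=; ring.
refine (is_derive_eq (is_derive_sum hk) _).
rewrite (bigD1 i)//= eqxx mul1r big1 ?addr0 ?mulr_natl// => k /negbTE ->.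
by rewrite mul0r mul0rn.
Qed.

Lemma is_derive_radial p z i y :
  is_derive y (evec R i) (fun w => p.[sqdist z w])
    (p^`().[sqdist z y] * (2 * (y - z) 0 i)).
Proof.
elim/poly_ind: p => [|p c IH].
  rewrite deriv0 horner0 mul0r.
  have -> : (fun w => (0 : {poly R}).[sqdist z w]) = cst 0.
    by apply/funext => w; rewrite horner0.
  exact: is_derive_cst.
have -> : (fun w => (p * 'X + c%:P).[sqdist z w]) =
    (fun w => p.[sqdist z w] * sqdist z w + c).
  by apply/funext => w; rewrite !hornerE.
rewrite derivD derivM derivX derivC addr0 mulr1 !hornerE.
have hM := is_deriveM IH (is_derive_sqdist z i y).
refine (is_derive_eq (is_deriveD hM (is_derive_cst c y (evec R i))) _).
by rewrite /= /GRing.scale /=; ring.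
Qed.

Lemma pderiv_radial p z i :
  pderiv i (fun w => p.[sqdist z w]) =
  (fun w => p^`().[sqdist z w] * (2 * (w - z) 0 i)).
Proof. by apply/funext => w; apply: derive_val; exact: is_derive_radial. Qed.

Lemma is_derive_radial2 p z i j y :
  is_derive y (evec R j) (fun w => p^`().[sqdist z w] * (2 * (w - z) 0 i))
    (p^`()^`().[sqdist z y] * (4 * (y - z) 0 i * (y - z) 0 j)
     + 2 * p^`().[sqdist z y] * (i == j)%:R).
Proof.
have hZ := is_deriveZ 2 (is_derive_coord z i j y).
refine (is_derive_eq (is_deriveM (is_derive_radial (p^`()) z j y) hZ) _).
by rewrite /= /GRing.scale /=; ring.
Qed.

Lemma pderiv_radial2 p z i j :
  pderiv j (pderiv i (fun w => p.[sqdist z w])) =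
  (fun y => p^`()^`().[sqdist z y] * (4 * (y - z) 0 i * (y - z) 0 j)
     + 2 * p^`().[sqdist z y] * (i == j)%:R).
Proof.
rewrite pderiv_radial; apply/funext => w; apply: derive_val.
exact: is_derive_radial2.
Qed.

Lemma continuous_mulr (f g : 'rV[R]_d -> R) :
  continuous f -> continuous g -> continuous (fun y => f y * g y).
Proof. by move=> cf cg y; exact: (continuousM (cf y) (cg y)). Qed.

Lemma continuous_addr (f g : 'rV[R]_d -> R) :
  continuous f -> continuous g -> continuous (fun y => f y + g y).
Proof. by move=> cf cg y; exact: (@continuousD R R^o _ _ _ _ (cf y) (cg y)). Qed.

Lemma continuous_cstr (c : R) : continuous (fun _ : 'rV[R]_d => c).
Proof. exact: cst_continuous. Qed.

Lemma coord_continuousB z i : continuous (fun y : 'rV[R]_d => (y - z) 0 i : R).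
Proof.
have -> : (fun y : 'rV[R]_d => (y - z) 0 i) = (fun y => y 0 i - z 0 i).
  by apply/funext => w; rewrite !mxE.
apply: continuous_addr; last exact: continuous_cstr.
exact: (@coord_continuous R 1 d 0 i).
Qed.

Lemma sqdist_continuous z : continuous (sqdist z).
Proof.
have -> : sqdist z = (fun y => enorm (y - z) * enorm (y - z)).
  by apply/funext => y; rewrite -expr2 enorm_sqr.
by apply: continuous_mulr; exact: enorm_continuous.
Qed.

Lemma radial_continuous p z : continuous (fun w => p.[sqdist z w]).
Proof.
by move=> y; apply: (continuous_comp (@sqdist_continuous z y)); exact: continuous_horner.
Qed.

Lemma C2_radial p z : C2 (fun w => p.[sqdist z w]).
Proof.
split.
- exact: radial_continuous.
- by move=> i x; apply: ex_derive; exact: is_derive_radial.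
- move=> i; rewrite pderiv_radial.
  apply: continuous_mulr; first exact: radial_continuous.
  by apply: continuous_mulr; [exact: continuous_cstr|exact: coord_continuousB].
- by move=> i j x; rewrite pderiv_radial; apply: ex_derive; exact: is_derive_radial2.
- move=> i j; rewrite pderiv_radial2; apply: continuous_addr.
    apply: continuous_mulr; first exact: radial_continuous.
    apply: continuous_mulr; last exact: coord_continuousB.
    by apply: continuous_mulr; [exact: continuous_cstr|exact: coord_continuousB].
  apply: continuous_mulr; last exact: continuous_cstr.
  by apply: continuous_mulr; [exact: continuous_cstr|exact: radial_continuous].
Qed.

Lemma grad_radial p z y :
  grad (fun w => p.[sqdist z w]) y = (2 * p^`().[sqdist z y]) *: (y - z).
Proof. by apply/rowP => i; rewrite mxE pderiv_radial !mxE; ring. Qed.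

Lemma hess_radial p z y :
  hess (fun w => p.[sqdist z w]) y =
  (4 * p^`()^`().[sqdist z y]) *: ((y - z)^T *m (y - z))
    + (2 * p^`().[sqdist z y])%:M.
Proof.
apply/matrixP => i j; rewrite [LHS]mxE pderiv_radial2 !mxE big_ord1 !mxE.
by rewrite -mulr_natr; ring.
Qed.

(** The gradient is a multiple of [y - z], an eigenvector of the Hessian, so the quotient is the
    corresponding eigenvalue, the second derivative in the radius. *)
Lemma inflap_radial p z y : y != z -> p^`().[sqdist z y] != 0 ->
  inflap (fun w => p.[sqdist z w]) y =
  4 * p^`()^`().[sqdist z y] * sqdist z y + 2 * p^`().[sqdist z y].
Proof.
move=> yz p0; have t0 : sqdist z y != 0.
  by apply: contra_neq yz => /dotp_eq0/subr0_eq.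
rewrite /inflap grad_radial hess_radial enormZ exprMn enorm_sqr -/(sqdist z y).
set A := p^`().[_] in p0 *; set B := p^`()^`().[_]; set D := y - z.
have DD : D *m D^T = (sqdist z y)%:M.
  apply/matrixP => i j; rewrite (ord1 i) (ord1 j) [LHS]mxE [RHS]mxE eqxx mulr1n.
  by apply: eq_bigr => k _; rewrite [D^T _ _]mxE.
have e : (2 * A) *: D *m ((4 * B) *: (D^T *m D) + (2 * A)%:M) =
    (2 * A * (4 * B * sqdist z y + 2 * A)) *: D.
  rewrite -scalemxAl mulmxDr -scalemxAr mulmxA DD mul_scalar_mx mul_mx_scalar.
  by rewrite !scalerA -scalerDl scalerA.
rewrite e -scalemxAl [((2 * A) *: D)^T]linearZ /= -scalemxAr DD !mxE eqxx mulr1n.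
rewrite real_normK ?num_real//.
by field; rewrite p0 t0.
Qed.

End RadialTest.

(** * From viscosity solutions to comparison with cones *)

Section ConeComparison.
Context {R : realType} {d : nat}.
Set Implicit Arguments. Unset Strict Implicit.
Implicit Types (x y z v : 'rV[R]_d) (p : {poly R}) (O : set 'rV[R]_d).

(** A fragment of the viscosity inequality shared by [u] and [- u]; with a nonzero gradient the
    upper and lower operators coincide. *)
Definition radial_subsolution O (u : 'rV[R]_d -> R) : Prop :=
  forall x z p, O x -> x != z -> p^`().[sqdist z x] != 0 ->
    loc_max_in O (fun y => u y - p.[sqdist z y]) x ->
    0 <= 4 * p^`()^`().[sqdist z x] * sqdist z x + 2 * p^`().[sqdist z x].

Lemma grad_radial_neq0 p z x : x != z -> p^`().[sqdist z x] != 0 ->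
  grad (fun y => p.[sqdist z y]) x != 0.
Proof.
move=> xz p0; rewrite grad_radial scaler_eq0 negb_or subr_eq0 xz andbT.
by rewrite mulf_neq0// pnatr_eq0.
Qed.

Lemma visc_sol_radial O (g u : 'rV[R]_d -> R) :
  visc_sol O (fun=> 0) g u -> radial_subsolution O u.
Proof.
move=> [_ _ vs] x z p Ox xz p0 lm.
have [/(_ lm) + _] := vs x _ Ox (C2_radial p z).
by rewrite /inflap_plus grad_radial_neq0// inflap_radial// oppr_le0.
Qed.

(** Touching [- u] from above by [p] is touching [u] from below by [- p], and the operator is odd
    where the gradient does not vanish. *)
Lemma visc_sol_radialN O (g u : 'rV[R]_d -> R) :
  visc_sol O (fun=> 0) g u -> radial_subsolution O (fun y => - u y).
Proof.
move=> [_ _ vs] x z p Ox xz p0 [r r0 lm].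
have p0' : (- p)^`().[sqdist z x] != 0 by rewrite derivN hornerN oppr_eq0.
have [_] := vs x _ Ox (C2_radial (- p) z).
rewrite /inflap_minus grad_radial_neq0// inflap_radial// !derivN !hornerN => h.
rewrite -subr_ge0 in h; suff /h : loc_min_in O (fun y => u y - (- p).[sqdist z y]) x by lra.
exists r => // y Oy yr; have := lm y Oy yr; rewrite !hornerN; lra.
Qed.

(* The bound is the Taylor expansion of [sqrt t] to third order at [t = r ^+ 2]. *)
Lemma id_le_cubic (r s : R) : 0 < r -> 0 <= s ->
  s <= r + (s ^+ 2 - r ^+ 2) / (2 * r) - (s ^+ 2 - r ^+ 2) ^+ 2 / (8 * r ^+ 3)
    + (s ^+ 2 - r ^+ 2) ^+ 3 / (16 * r ^+ 5).
Proof.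
move=> r0 s0; rewrite -subr_ge0.
have -> : r + (s ^+ 2 - r ^+ 2) / (2 * r) - (s ^+ 2 - r ^+ 2) ^+ 2 / (8 * r ^+ 3)
    + (s ^+ 2 - r ^+ 2) ^+ 3 / (16 * r ^+ 5) - s =
    (s - r) ^+ 4 * (s ^+ 2 + 4 * s * r + 5 * r ^+ 2) / (16 * r ^+ 5).
  by field; rewrite gt_eqF.
have r5 : 0 < r ^+ 5 by rewrite exprn_gt0.
apply: divr_ge0; last by lra.
apply: mulr_ge0; first by rewrite exprn_even_ge0.
by rewrite !addr_ge0 ?mulr_ge0 ?exprn_ge0 ?(ltW r0).
Qed.

Definition cone_above O (u : 'rV[R]_d -> R) : Prop :=
  forall z r M, 0 < r -> (forall y, enorm (y - z) <= r -> O y) ->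
    (forall y, enorm (y - z) <= r -> u y <= M) ->
    forall y, enorm (y - z) <= r -> u y <= u z + (M - u z) * (enorm (y - z) / r).

Lemma sqdistE z y : sqdist z y = enorm (y - z) ^+ 2.
Proof. by rewrite enorm_sqr. Qed.

(** If the bound fails at [y], then [u] minus a slightly concave cone has a maximum away from both
    the centre and the sphere. A smooth radial polynomial touching that cone from above there has
    negative infinity Laplacian, a contradiction. *)
Lemma radial_cone_above O (u : 'rV[R]_d -> R) :
  {within closure O, continuous u} -> radial_subsolution O u -> cone_above O u.
Proof.
move=> cu ru z r M r0 ballO uM y yr; rewrite leNgt; apply/negP => lt.
have [yz|yz] := eqVneq (enorm (y - z)) 0.
  by move: lt; rewrite yz mul0r mulr0 addr0 (subr0_eq (enorm_eq0 yz)) ltxx.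
have rho : 0 < enorm (y - z) by rewrite lt_def yz enorm_ge0.
pose a := (u y - u z) / enorm (y - z).
have zz : enorm (z - z) <= r by rewrite subrr enorm0 ltW.
have Mz : u z <= M by exact: uM.
have ar : M - u z < a * r.
  by rewrite -ltr_pdivrMr// /a ltr_pdivlMr//; move: lt; lra.
have a0 : 0 < a by rewrite -(pmulr_lgt0 _ r0); lra.
(* [b] makes the cone strictly concave in the radius, small enough to keep it above [M] on the sphere. *)
pose b := Num.min ((a * r - (M - u z)) / (2 * r ^+ 2)) (a / (4 * r)).
have b0 : 0 < b.
  rewrite lt_min; apply/andP; split; apply: divr_gt0; rewrite ?subr_gt0//.
    by rewrite mulr_gt0 ?exprn_gt0.
  by rewrite mulr_gt0.
have br : b * r ^+ 2 < a * r - (M - u z).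
  have : b <= (a * r - (M - u z)) / (2 * r ^+ 2) by rewrite ge_min lexx.
  rewrite ler_pdivlMr ?mulr_gt0 ?exprn_gt0//; lra.
have ba : 4 * (b * r) <= a.
  have : b <= a / (4 * r) by rewrite ge_min lexx orbT.
  by rewrite ler_pdivlMr ?mulr_gt0//; lra.
pose w x := u x - (a * enorm (x - z) + (- b) * (enorm (x - z) * enorm (x - z))).
have cw : {within [set x | enorm (x - z) <= r], continuous w}.
  apply: (@within_continuousB _ R R^o).
    by apply: continuous_subspaceW cu => x /ballO; exact: subset_closure.
  apply: continuous_subspaceT; apply: continuous_addr; apply: continuous_mulr.
  - exact: continuous_cstr.
  - exact: enorm_continuous.
  - exact: continuous_cstr.
  - by apply: continuous_mulr; exact: enorm_continuous.
have [c cr cmax] := ball_has_max (ltW r0) cw.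
have wz : w z = u z by rewrite /w subrr enorm0 mulr0 mul0r mulr0 addr0 subr0.
have uay : u y = u z + a * enorm (y - z) by rewrite /a divfK // addrC subrK.
have wy : u z < w y.
  by rewrite /w uay; have := mulr_gt0 b0 (mulr_gt0 rho rho); lra.
have wc : u z < w c by exact: lt_le_trans wy (cmax _ yr).
have cz : c != z by apply: contraTneq wc => ->; rewrite wz ltxx.
have s0 : 0 < enorm (c - z).
  rewrite lt_def enorm_ge0 andbT; apply: contra_neq cz => /enorm_eq0.
  exact: subr0_eq.
have sr : enorm (c - z) < r.
  rewrite lt_neqAle cr andbT; apply/eqP => cr'.
  by move: wc; rewrite /w cr'; have := uM c cr; move: br; rewrite expr2; lra.
set s := enorm (c - z) in s0 sr.
(* In the concave cone, the distance is replaced by the cubic of [id_le_cubic] expanded at radius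
   [s]. Since [0 < a], [p] lies above the cone with equality at [c], so [c] remains a maximum. *)
pose p : {poly R} := (a * s)%:P + (a / (2 * s)) *: ('X - (s ^+ 2)%:P)
  - (a / (8 * s ^+ 3)) *: ('X - (s ^+ 2)%:P) ^+ 2
  + (a / (16 * s ^+ 5)) *: ('X - (s ^+ 2)%:P) ^+ 3 - b *: 'X.
have sn : s != 0 by rewrite gt_eqF.
have pE t : p.[t] = a * (s + (t - s ^+ 2) / (2 * s)
    - (t - s ^+ 2) ^+ 2 / (8 * s ^+ 3) + (t - s ^+ 2) ^+ 3 / (16 * s ^+ 5)) - b * t.
  by rewrite /p !(hornerD, hornerN, hornerZ, hornerC, hornerX, horner_exp); field.
have dp : p^`().[s ^+ 2] = a / (2 * s) - b.
  by rewrite /p !poly.derivE !(hornerD, hornerN, hornerZ, hornerC, hornerX, horner_exp, hornerM) /=; ring.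
have ddp : p^`()^`().[s ^+ 2] = - (a / (4 * s ^+ 3)).
  by rewrite /p !poly.derivE !(hornerD, hornerN, hornerZ, hornerC, hornerX, horner_exp, hornerM) /=; field.
have dp0 : p^`().[sqdist z c] != 0.
  rewrite sqdistE -/s dp gt_eqF// subr_gt0 ltr_pdivlMr ?mulr_gt0//.
  have : b * s < b * r by rewrite ltr_pM2l.
  have := mulr_gt0 b0 r0; lra.
have /(ru _ _ _ (ballO c cr) cz dp0) : loc_max_in O (fun y => u y - p.[sqdist z y]) c.
  exists (r - s); rewrite ?subr_gt0// => x Ox xc.
  have xr : enorm (x - z) <= r by have := enormB_triangle c x z; rewrite -/s; lra.
  have := cmax x xr; rewrite /w -/s !sqdistE -/s !pE subrr.
  have := id_le_cubic s0 (enorm_ge0 (x - z)); rewrite -(ler_pM2l a0); lra.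
rewrite sqdistE -/s dp ddp.
(* The slope [a] cancels, cones being infinity harmonic off their vertex; only the concave
   correction remains. *)
have -> : 4 * - (a / (4 * s ^+ 3)) * s ^+ 2 + 2 * (a / (2 * s) - b) = - 2 * b by field.
lra.
Qed.

End ConeComparison.

(** * Steepening a subsolution on an abstract graph *)

Section Steepen.
Context {R : realType} {X : Type}.
Set Implicit Arguments. Unset Strict Implicit.
Variables (rel : X -> X -> Prop) (int : X -> Prop) (v : X -> R) (c : R).
Implicit Types (x y : X) (n : nat).

(* Points where [v] cannot be increased by [c] in one step; [steepen] modifies [v] there. *)
Definition flat x : Prop := int x /\ forall y, rel x y -> v y < v x + c.

Fixpoint flat_path n x y : Prop :=
  if n is n'.+1 then flat x /\ exists2 x', rel x x' & flat_path n' x' y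
  else x = y /\ ~ flat x.

(** Points outside [int] are never flat, so this bounds the length of some chain leading out of the
    flat region. *)
Fixpoint exits n x : Prop :=
  if n is n'.+1 then ~ int x \/ exists2 y, rel x y & exits n' y else ~ int x.

Definition path_values x : set R :=
  [set t | exists n y, flat_path n x y /\ t = v y - n%:R * c].

Definition steepen x : R := sup (path_values x).

Hypothesis c_gt0 : 0 < c.
Hypothesis rel_sym : forall x y, rel x y -> rel y x.
Hypothesis step : forall x, int x -> exists2 y, rel x y &
  forall y', rel x y' -> v y' <= v y /\ 2 * v x <= v y + v y'.

(** Each step of a flat chain gains less than [c] and costs [c]. *)
Lemma path_values_le x t : path_values x t -> t <= v x.
Proof.
move=> [n [y [h ->]]]; elim: n x h => [x [-> _]|n IH x [[_ fx] [x' xx' /IH h]]].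
  by rewrite mul0r subr0.
have := fx _ xx'; rewrite -natr1; lra.
Qed.

(** The midpoint inequality turns the bound on increases at a flat point into one on decreases. *)
Lemma flat_backstep x y : flat x -> rel x y -> v x - c <= v y.
Proof.
move=> [ix fx] xy; have [y' xy' h] := step ix.
have := fx _ xy'; have [_] := h _ xy; lra.
Qed.

(** The exiting chain is cut at its first point that is not flat; by [flat_backstep] the value drops
    by at most [c] per step before it. *)
Lemma exits_path n x : exits n x ->
  exists m y, [/\ (m <= n)%N, flat_path m x y & v x - m%:R * c <= v y].
Proof.
elim: n x => [x nx|n IH x h].
  by exists 0%N, x; split=> //; [split=> // -[]|rewrite mul0r subr0].
have [fx|nfx] := pselect (flat x); last first.
  by exists 0%N, x; split=> //; rewrite mul0r subr0.
case: h => [nx|[y xy /IH[m [y' [mn p hv]]]]]; first by case: nx; case: fx.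
exists m.+1, y'; split=> //; first by split=> //; exists y.
have := flat_backstep fx xy; rewrite -natr1; lra.
Qed.

Variable N : nat.
Hypothesis all_exit : forall x, exits N x.

(** The factor 2 adds the drop of [v] along the chain to the cost of its steps. *)
Lemma path_values_ge x : exists2 t, path_values x t & v x - 2 * (N%:R * c) <= t.
Proof.
have [m [y [mN p h]]] := exits_path (all_exit x).
exists (v y - m%:R * c); first by exists m, y.
have : m%:R * c <= N%:R * c by rewrite ler_pM2r// ler_nat.
lra.
Qed.

Lemma path_values_sup x : has_sup (path_values x).
Proof.
split; first by have [t ht _] := path_values_ge x; exists t.
by exists (v x) => t; exact: path_values_le.
Qed.

Lemma steepen_le x : steepen x <= v x.
Proof.
apply: ge_sup; first by have [] := path_values_sup x.
by move=> t; exact: path_values_le.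
Qed.

Lemma path_value_le_steepen x t : path_values x t -> t <= steepen x.
Proof. by move=> h; apply: sup_upper_bound => //; exact: path_values_sup. Qed.

Lemma steepen_ge x : v x - 2 * (N%:R * c) <= steepen x.
Proof.
by have [t /path_value_le_steepen h1 h2] := path_values_ge x; exact: le_trans h2 h1.
Qed.

Lemma steepen_steep x : ~ flat x -> steepen x = v x.
Proof.
move=> nfx; apply/eqP; rewrite eq_le steepen_le /=; apply: path_value_le_steepen.
by exists 0%N, x; rewrite mul0r subr0.
Qed.

Lemma steepen_flat_step x y : flat x -> rel x y -> steepen y - c <= steepen x.
Proof.
move=> fx xy; rewrite lerBlDr; apply: ge_sup; first by have [] := path_values_sup y.
move=> t [n [y' [p ->]]]; rewrite -lerBlDr.
apply: path_value_le_steepen; exists n.+1, y'; split; last by rewrite -natr1; ring.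
by split=> //; exists y.
Qed.

(** Where [x] is not flat the best neighbour for [v] still serves. Where [x] is flat, a chain
    supplies a neighbour gaining [c], and no neighbour loses more than [c]. The slack [t] allows for
    a supremum that is not attained. *)
Lemma steepen_step x t : int x -> 0 < t -> exists y, [/\ rel x y,
  steepen x + c - t <= steepen y &
  forall y', rel x y' -> 2 * steepen x <= steepen y + steepen y' + t].
Proof.
move=> ix t0; have [y xy hy] := step ix.
have [fx|nfx] := pselect (flat x); last first.
  rewrite (steepen_steep nfx).
  have vy : v x + c <= v y.
    rewrite leNgt; apply/negP => h; apply: nfx; split=> // y' /hy[]; lra.
  (* Were [y] flat, the midpoint inequality at [y] against [x] would yield a neighbour gaining at
     least [c]. *)
  have nfy : ~ flat y.
    move=> fy; have [iy fy'] := fy; have [z yz /(_ _ (rel_sym xy))[_ +]] := step iy.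
    have := fy' _ yz; lra.
  exists y; rewrite (steepen_steep nfy); split=> //; first by lra.
  move=> y' xy'; have [fy'|nfy'] := pselect (flat y').
    have := steepen_flat_step fy' (rel_sym xy'); rewrite (steepen_steep nfx); lra.
  by rewrite (steepen_steep nfy'); have [_] := hy _ xy'; lra.
(* The first step of a nearly optimal chain is the required neighbour, the rest being a chain from
   it. *)
have [u [n [w [p ->]]] hu] := sup_adherent t0 (path_values_sup x).
case: n p hu => [[_ nfx]//|n [_ [x' xx' p]]] hu.
have px' : steepen x + c - t <= steepen x'.
  have : v w - n%:R * c <= steepen x' by apply: path_value_le_steepen; exists n, w.
  move: hu; rewrite -/(steepen x) -natr1; lra.
exists x'; split=> // y' xy'; suff : steepen x - c <= steepen y' by lra.
have [fy'|nfy'] := pselect (flat y'); first exact: steepen_flat_step (rel_sym xy').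
by rewrite (steepen_steep nfy'); have := flat_backstep fx xy'; have := steepen_le x; lra.
Qed.

End Steepen.

(** * Suprema over balls *)

Section BallSup.
Context {R : realType} {d : nat}.
Set Implicit Arguments. Unset Strict Implicit.
Variables (O : set 'rV[R]_d) (K : R) (f : 'rV[R]_d -> R).
Implicit Types (x y z : 'rV[R]_d) (r : R).

(** Cutting the ball off at [O] allows centres on the boundary, where mesh nodes may lie. *)
Definition ball_sup r x : R := sup [set f y | y in [set y | O y /\ enorm (y - x) <= r]].

Hypothesis fK : forall x, O x -> `|f x| <= K.

Lemma ball_sup_ge r x y : O y -> enorm (y - x) <= r -> f y <= ball_sup r x.
Proof.
move=> Oy yx; apply: ub_le_sup; last by exists y.
by exists K => _ [w [Ow _] <-]; rewrite (le_trans (ler_norm _)) ?fK.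
Qed.

Lemma ball_sup_le r x M : (exists2 y, O y & enorm (y - x) <= r) ->
  (forall y, O y -> enorm (y - x) <= r -> f y <= M) -> ball_sup r x <= M.
Proof.
move=> [y Oy yx] h; apply: ge_sup; first by exists (f y), y.
by move=> _ [w [Ow wx] <-]; exact: h.
Qed.

Lemma ball_sup_bound r x : (exists2 y, O y & enorm (y - x) <= r) ->
  `|ball_sup r x| <= K.
Proof.
move=> hy; rewrite ler_norml; apply/andP; split; last first.
  by apply: ball_sup_le => // w Ow _; rewrite (le_trans (ler_norm _)) ?fK.
have [y Oy yx] := hy; apply: le_trans (ball_sup_ge Oy yx).
by have := fK Oy; rewrite ler_norml => /andP[].
Qed.

Lemma ball_sup0 x : O x -> ball_sup 0 x = f x.
Proof.
move=> Ox; apply/eqP; rewrite eq_le ball_sup_ge ?subrr ?enorm0// andbT.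
apply: ball_sup_le; first by exists x; rewrite ?subrr ?enorm0.
move=> y _ h; suff -> : y = x by [].
by apply/subr0_eq/enorm_eq0/le_anti; rewrite h enorm_ge0.
Qed.

Lemma retract z y t : 0 <= t <= 1 ->
  enorm (z + (1 - t) *: (y - z) - z) = (1 - t) * enorm (y - z) /\
  enorm (z + (1 - t) *: (y - z) - y) = t * enorm (y - z).
Proof.
move=> /andP[t0 t1]; split; first by rewrite addrC addKr enormZ ger0_norm ?subr_ge0.
have -> : z + (1 - t) *: (y - z) - y = (- t) *: (y - z).
  by apply/rowP => i; rewrite !mxE; ring.
by rewrite enormZ normrN ger0_norm.
Qed.

End BallSup.

(** * Steps of length [s] and convexity in the radius *)

Section StepGraph.
Context {R : realType} {d : nat}.
Set Implicit Arguments. Unset Strict Implicit.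
Variables (O : set 'rV[R]_d) (K s : R).
Hypothesis s_gt0 : 0 < s.
Implicit Types (x y z : 'rV[R]_d).

Definition near_step x y : Prop := [/\ O x, O y & enorm (y - x) <= s].
(** One [s] is for the step, the other for the ball over which the supremum at the neighbour is
    taken. *)
Definition deep x : Prop := forall y, enorm (y - x) <= 2 * s -> O y.

Lemma near_step_sym x y : near_step x y -> near_step y x.
Proof. by case=> Ox Oy h; split=> //; rewrite enormBC. Qed.

Lemma deep_in x : deep x -> O x.
Proof. by apply; rewrite subrr enorm0 mulr_ge0// ltW. Qed.

(** Let [c] maximize [u] over the ball of radius [2 * s]. The neighbour halfway to [c] sees [u c],
    every neighbour sees at least [u x], and comparison with cones bounds the supremum at [x] by the
    mean of [u x] and [u c]. *)
Lemma ball_sup_step (u : 'rV[R]_d -> R) x :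
  (forall y, O y -> `|u y| <= K) -> {within closure O, continuous u} ->
  cone_above O u -> deep x ->
  exists2 y, near_step x y & forall y', near_step x y' ->
    ball_sup O u s y' <= ball_sup O u s y /\
    2 * ball_sup O u s x <= ball_sup O u s y + ball_sup O u s y'.
Proof.
move=> uK cu ca dx; have Ox := deep_in dx; have s0 := ltW s_gt0.
have s20 : 0 < 2 * s by rewrite mulr_gt0.
have cu' : {within [set y | enorm (y - x) <= 2 * s], continuous u}.
  by apply: continuous_subspaceW cu => y /dx; exact: subset_closure.
have [c cr cmax] := ball_has_max (ltW s20) cu'.
have Oc := dx _ cr.
have half : 0 <= (2^-1 : R) <= 1 by lra.
have [yx yc] := retract x c half; set y := x + _ in yx yc.
have ys : enorm (y - x) <= s by rewrite yx; lra.
have Oy : O y by apply: dx; lra.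
have vy : u c <= ball_sup O u s y.
  by apply: (ball_sup_ge uK Oc); rewrite enormBC yc; lra.
exists y; first by split.
move=> y' [_ Oy' y'x].
have vy' : ball_sup O u s y' <= u c.
  apply: ball_sup_le; first by exists y'; rewrite ?subrr ?enorm0.
  by move=> w _ wy'; apply: cmax; have := enormB_triangle y' w x; lra.
have vx' : u x <= ball_sup O u s y' by apply: (ball_sup_ge uK Ox); rewrite enormBC.
have xx : enorm (x - x) <= 2 * s by rewrite subrr enorm0 ltW.
have vx : ball_sup O u s x <= (u x + u c) / 2.
  apply: ball_sup_le; first by exists x; rewrite ?subrr ?enorm0.
  move=> w _ wx; have wx2 : enorm (w - x) <= 2 * s by lra.
  have := ca x (2 * s) (u c) s20 dx cmax w wx2.
  have : (u c - u x) * (enorm (w - x) / (2 * s)) <= (u c - u x) * 2^-1.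
    apply: ler_wpM2l; first by rewrite subr_ge0 cmax.
    by rewrite ler_pdivrMr//; lra.
  lra.
lra.
Qed.

(** Walking along a coordinate axis raises that coordinate by [s] per step, and it is bounded on
    [O]. *)
Lemma exits_bounded (i : 'I_d) (B : R) n x :
  (forall y, O y -> y 0 i <= B) -> (O x -> B - x 0 i < n%:R * s) ->
  exits near_step deep n x.
Proof.
move=> hB; elim: n x => [|n IH] x h /=.
  move=> dx; have Ox := deep_in dx; have := h Ox; have := hB _ Ox; lra.
have [dx|] := pselect (deep x); last by left.
right; pose y := x + s *: evec R i.
have yx : enorm (y - x) = s.
  rewrite /y addrC addKr enormZ gtr0_norm// /enorm /dotp (bigD1 i)//= big1.
    by rewrite !mxE !eqxx mulr1 addr0 sqrtr1 mulr1.
  by move=> j ji; rewrite !mxE eqxx (negbTE ji) mul0r.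
have Oy : O y by apply: dx; rewrite yx; have := s_gt0; lra.
exists y; first by split=> //; [exact: deep_in|rewrite yx].
apply: IH => _; have := h (deep_in dx).
by rewrite /y !mxE !eqxx mulr1 -natr1; lra.
Qed.

Variables (F : 'rV[R]_d -> R) (c : R).
Hypothesis FK : forall x, O x -> `|F x| <= K.
Hypothesis Fstep : forall x (t : R), deep x -> 0 < t -> exists y, [/\ near_step x y,
  F x + c - t <= F y &
  forall y', near_step x y' -> 2 * F x <= F y + F y' + t].

Lemma convex_seq (m : nat -> R) l :
  (forall j, (j.+1 < l)%N -> 2 * m j.+1 <= m j + m j.+2) ->
  forall k, (k <= l)%N -> l%:R * (m k - m 0%N) <= k%:R * (m l - m 0%N).
Proof.
move=> conv.
have slope k : (k < l)%N -> k.+1%:R * m k <= k%:R * m k.+1 + m 0%N.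
  elim: k => [|k IH] kl; first by lra.
  have /IH := ltnW kl; have := conv k kl.
  rewrite -!natr1 -(ler_pM2l (_ : 0 < k%:R + 1)) ?natr1 ?ltr0n// -!natr1; lra.
elim: l => [|l IH] in conv slope *.
  by move=> k; rewrite leqn0 => /eqP ->.
move=> k; rewrite leq_eqVlt => /orP[/eqP -> //|kl].
have h1 : l%:R * (m k - m 0%N) <= k%:R * (m l - m 0%N).
  by apply: IH => // j jl; [apply: conv|apply: slope]; rewrite ltnS ltnW.
have h2 := slope l (ltnSn l); case: l => [|l] in kl h1 h2 conv slope IH *.
  by case: k kl h1 => // _ _; lra.
have l0 : 0 < (l.+1%:R : R) by rewrite ltr0n.
rewrite -(ler_pM2l l0).
have h3 : l.+2%:R * (l.+1%:R * (m k - m 0%N)) <= l.+2%:R * (k%:R * (m l.+1 - m 0%N)).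
  by rewrite ler_pM2l ?ltr0n.
have h4 : k%:R * (l.+2%:R * m l.+1) <= k%:R * (l.+1%:R * m l.+2 + m 0%N).
  by rewrite ler_wpM2l ?ler0n.
move: h3 h4; rewrite -(natr1 l.+1); lra.
Qed.

Variables (z : 'rV[R]_d) (l : nat).
Hypothesis ball_in : forall y, enorm (y - z) <= l.+2%:R * s -> O y.
Let m j := ball_sup O F (j%:R * s) z.

Lemma ball_deep j y : (j <= l)%N -> enorm (y - z) <= j%:R * s -> deep y.
Proof.
move=> jl yz w wy; apply: ball_in; have := enormB_triangle y w z.
have : j%:R * s <= l%:R * s by rewrite ler_pM2r// ler_nat.
by rewrite -[l.+2]addn2 natrD; lra.
Qed.

Lemma ball_centre j : exists2 y, O y & enorm (y - z) <= j%:R * s.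
Proof.
exists z; last by rewrite subrr enorm0 mulr_ge0// ltW.
by apply: ball_in; rewrite subrr enorm0 mulr_ge0// ltW.
Qed.

(** For [y] in the middle ball, the gaining neighbour lies in the larger ball, and the point [w],
    one step from [y] towards [z], in the smaller one; the difference inequality at [y] links the
    three. *)
Lemma ball_sup_convex j : (j.+1 <= l)%N -> 2 * m j.+1 <= m j + m j.+2.
Proof.
move=> jl; suff : m j.+1 <= (m j + m j.+2) / 2 by lra.
apply: ball_sup_le; first exact: ball_centre.
move=> y Oy yz; apply/ler_addgt0Pr => t t0.
have [y1 [[_ Oy1 y1y] _ h]] := Fstep (ball_deep jl yz) t0.
have j0 : 0 < (j.+1%:R : R) by rewrite ltr0n.
have jinv : 0 <= (j.+1%:R : R)^-1 <= 1.
  by rewrite invr_ge0 ltW//= invf_le1// ler1n.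
have [wz wy] := retract z y jinv; set w := z + _ in wz wy.
have wys : enorm (w - y) <= s by rewrite wy mulrC ler_pdivrMr// mulrC.
have wzs : enorm (w - z) <= j%:R * s.
  have -> : j%:R * s = (1 - j.+1%:R^-1) * (j.+1%:R * s).
    by rewrite -natr1; field; rewrite natr1 gt_eqF.
  by rewrite wz ler_wpM2l// subr_ge0; case/andP: jinv.
have Ow : O w by apply: (deep_in (ball_deep (ltnW jl) wzs)).
have y1z : enorm (y1 - z) <= j.+2%:R * s.
  by have := enormB_triangle y y1 z; rewrite -(natr1 j.+1); lra.
have := h w (And3 Oy Ow wys).
have := ball_sup_ge FK Ow wzs; have := ball_sup_ge FK Oy1 y1z; rewrite -!/(m _); lra.
Qed.

Lemma ball_sup_slope j : (j <= l)%N -> m j + c <= m j.+1.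
Proof.
move=> jl; suff : m j <= m j.+1 - c by lra.
apply: ball_sup_le; first exact: ball_centre.
move=> y Oy yz; apply/ler_addgt0Pr => t t0.
have [y1 [[_ Oy1 y1y] h _]] := Fstep (ball_deep jl yz) t0.
have y1z : enorm (y1 - z) <= j.+1%:R * s.
  by have := enormB_triangle y y1 z; rewrite -(natr1 j); lra.
by have := ball_sup_ge FK Oy1 y1z; rewrite -/(m _); lra.
Qed.

Lemma ball_sup_center : m 0%N = F z.
Proof.
rewrite /m mul0r; apply: (ball_sup0 FK).
by apply: ball_in; rewrite subrr enorm0 mulr_ge0// ltW.
Qed.

Lemma ball_sup_radial k : (k <= l)%N ->
  l%:R * (m k - F z) <= k%:R * (m l - F z) /\ l%:R * c <= m l - F z.
Proof.
move=> kl; rewrite -ball_sup_center; split.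
  by apply: convex_seq => // j jl; apply: ball_sup_convex; exact: ltnW.
elim: {-2}(l) (leqnn l) => [|j IH] jl; first by rewrite mul0r subrr.
by have := IH (ltnW jl); have := ball_sup_slope (ltnW jl); rewrite -natr1; lra.
Qed.

End StepGraph.

(** * Barycentric coordinates, interpolation and mesh geometry *)

Section Mesh.
Context {R : realType} {d : nat}.
Set Implicit Arguments. Unset Strict Implicit.
Local Notation pt := 'rV[R]_d.
Local Notation simplex := {ffun 'I_d.+1 -> pt}.
Implicit Types (T : simplex) (M : mesh R d) (w : pt -> R) (x y z : pt).

Lemma comb_edge T (lam : 'rV[R]_d.+1) :
  comb T lam = (\row_i lam 0 (lift ord0 i)) *m edge_mx T
    + (\sum_i lam 0 i) *: T ord0.
Proof.
rewrite /comb big_ord_recl [\sum_i lam 0 i]big_ord_recl scalerDl scaler_suml.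
rewrite addrCA; congr (_ + _).
rewrite mulmx_sum_row -big_split /=; apply: eq_bigr => i _.
by rewrite mxE rowK -scalerDr subrK.
Qed.

Lemma comb_eq0 T (nu : 'rV[R]_d.+1) : \det (edge_mx T) != 0 ->
  \sum_i nu 0 i = 0 -> comb T nu = 0 -> nu = 0.
Proof.
move=> dT s0; rewrite comb_edge s0 scale0r addr0 => e.
have uT : edge_mx T \in unitmx by rewrite unitmxE unitfE.
have nu' : \row_i nu 0 (lift ord0 i) = 0 :> 'rV[R]_d.
  by rewrite -(mulmxK uT (\row_i _)) e mul0mx.
have nuE i : nu 0 (lift ord0 i) = 0.
  by have /rowP/(_ i) := nu'; rewrite !mxE.
apply/rowP => i; rewrite mxE; case: (unliftP ord0 i) => [j ->|->]; first exact: nuE.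
by move: s0; rewrite big_ord_recl big1 ?addr0// => j _; exact: nuE.
Qed.

Lemma combB T (lam mu : 'rV[R]_d.+1) : comb T (lam - mu) = comb T lam - comb T mu.
Proof. by rewrite /comb -sumrB; apply: eq_bigr => i _; rewrite !mxE scalerBl. Qed.

Lemma comb_inj T (lam mu : 'rV[R]_d.+1) : \det (edge_mx T) != 0 ->
  \sum_i lam 0 i = \sum_i mu 0 i -> comb T lam = comb T mu -> lam = mu.
Proof.
move=> dT es ec; apply: subr0_eq; apply: (comb_eq0 dT); last by rewrite combB ec subrr.
under eq_bigr => i _ do rewrite !mxE.
by rewrite sumrB es subrr.
Qed.

Lemma bary_comb T (lam : 'rV[R]_d.+1) : \det (edge_mx T) != 0 ->
  \sum_i lam 0 i = 1 -> bary T (comb T lam) = lam.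
Proof.
move=> dT s1; apply: xget_subset1; first by split.
by move=> a b [a1 ea] [b1 eb]; apply: (comb_inj dT); rewrite ?a1 ?b1// -ea -eb.
Qed.

Lemma sum_delta (i : 'I_d.+1) (c : 'I_d.+1 -> R) :
  \sum_j (delta_mx 0 i : 'rV[R]_d.+1) 0 j * c j = c i.
Proof.
rewrite (bigD1 i)//= mxE !eqxx mul1r big1 ?addr0// => j ji.
by rewrite mxE (negbTE ji) andbF mul0r.
Qed.

Lemma sum_delta1 (i : 'I_d.+1) : \sum_j (delta_mx 0 i : 'rV[R]_d.+1) 0 j = 1.
Proof. by rewrite -[RHS](sum_delta i (fun=> 1)); apply: eq_bigr => j _; rewrite mulr1. Qed.

Lemma comb_coord T (lam : 'rV[R]_d.+1) j :
  comb T lam 0 j = \sum_i lam 0 i * T i 0 j.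
Proof. by rewrite /comb summxE; apply: eq_bigr => i _; rewrite mxE. Qed.

Lemma comb_delta T i : comb T (delta_mx 0 i) = T i.
Proof. by apply/rowP => j; rewrite comb_coord sum_delta. Qed.

Lemma vertex_inj T : \det (edge_mx T) != 0 -> injective T.
Proof.
move=> dT i j eT; have : delta_mx 0 i = delta_mx 0 j :> 'rV[R]_d.+1.
  by apply: (comb_inj dT); rewrite ?sum_delta1// !comb_delta.
move=> /matrixP/(_ 0 i); rewrite !mxE !eqxx /=.
by case: (eqVneq i j) => // _ /eqP; rewrite oner_eq0.
Qed.

Lemma sum_vertices T (lam : 'rV[R]_d.+1) w z :
  \sum_(i | T i == z) lam 0 i * w (T i) = (\sum_(i | T i == z) lam 0 i) * w z.
Proof. by rewrite mulr_suml; apply: eq_bigr => i /eqP ->. Qed.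

(** Weights carried by shared vertices are regrouped on the vertices of [T'], so every weighted sum
    is preserved. This makes hat functions independent of the simplex chosen in [hat]. *)
Lemma sum_common_face T T' (lam : 'rV[R]_d.+1) w : injective T' ->
  (forall i, T i \notin codom (fun k => T' k) -> lam 0 i = 0) ->
  \sum_k (\row_j \sum_(i | T i == T' j) lam 0 i) 0 k * w (T' k)
    = \sum_i lam 0 i * w (T i).
Proof.
move=> iT' h; under eq_bigr => k _ do rewrite mxE -sum_vertices.
rewrite (exchange_big_dep predT)//=; apply: eq_bigr => i _.
have [/codomP[k Tk]|/h ->] := boolP (T i \in codom (fun k => T' k)).
  rewrite (big_pred1 k)// => j /=; rewrite Tk; apply/eqP/eqP => [/iT' ->//|->//].
by rewrite mul0r big1// => j _; rewrite mul0r.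
Qed.

Lemma bary_atE T x z : bary_at T x z = \sum_i bary T x 0 i * (T i == z)%:R.
Proof.
rewrite /bary_at big_mkcond; apply: eq_bigr => i _.
by case: (T i == z); rewrite ?mulr1 ?mulr0.
Qed.

Lemma bary_at_unique M T T' x z : valid_mesh M -> T \in M -> T' \in M ->
  simplex_set T x -> simplex_set T' x -> bary_at T x z = bary_at T' x z.
Proof.
move=> [_ [dM fM]] TM TM' Tx Tx'.
have : (simplex_set T `&` simplex_set T') x by split.
rewrite fM// => -[lam [l0 l1 lf xE]].
have iT' := vertex_inj (dM _ TM').
pose mu : 'rV[R]_d.+1 := \row_j \sum_(i | T i == T' j) lam 0 i.
have muE w : \sum_k mu 0 k * w (T' k) = \sum_i lam 0 i * w (T i).
  exact: sum_common_face.
have mu1 : \sum_k mu 0 k = 1.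
  rewrite -l1 -[RHS](eq_bigr _ (fun i _ => mulr1 (lam 0 i))) -(muE (fun=> 1)).
  by apply: eq_bigr => i _; rewrite mulr1.
have xE' : x = comb T' mu.
  by rewrite xE; apply/rowP => j; rewrite !comb_coord (muE (fun p => p 0 j)).
rewrite !bary_atE {1}xE (bary_comb (dM _ TM) l1) xE' (bary_comb (dM _ TM') mu1).
by rewrite (muE (fun p => (p == z)%:R)).
Qed.

Lemma hatE M T x z : valid_mesh M -> T \in M -> simplex_set T x ->
  hat M z x = bary_at T x z.
Proof.
move=> vM TM Tx; apply: xget_subset1; first by exists T.
move=> a b [T1 M1 [x1 ->]] [T2 M2 [x2 ->]]; exact: (bary_at_unique _ vM).
Qed.

Lemma vertex_node M T i : T \in M -> T i \in nodes M.
Proof.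
move=> TM; rewrite mem_undup; apply/flattenP; exists (codom (fun k => T k)).
  by apply/mapP; exists T.
exact: codom_f.
Qed.

Lemma nodeP M z : z \in nodes M -> exists T i, T \in M /\ z = T i.
Proof.
by rewrite mem_undup => /flattenP[_ /mapP[T TM ->] /codomP[i ->]]; exists T, i.
Qed.

Lemma interpE M T x w : valid_mesh M -> T \in M -> simplex_set T x ->
  interp M w x = \sum_i bary T x 0 i * w (T i).
Proof.
move=> vM TM Tx; rewrite /interp.
under eq_bigr => z _ do rewrite (hatE z vM TM Tx) bary_atE mulr_sumr.
rewrite exchange_big; apply: eq_bigr => i _ /=.
rewrite (bigD1_seq (T i)) ?vertex_node ?undup_uniq//= eqxx mulr1 mulrC big1 ?addr0//.
by move=> z; rewrite eq_sym => /negbTE ->; rewrite !mulr0.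
Qed.

(** The convex weights do not depend on [w], so two interpolants can be compared vertex by
    vertex. *)
Lemma interp_average M x : valid_mesh M -> mesh_union M x ->
  exists T (lam : 'rV[R]_d.+1), [/\ T \in M, simplex_set T x,
    forall i, 0 <= lam 0 i, \sum_i lam 0 i = 1 &
    forall w, interp M w x = \sum_i lam 0 i * w (T i)].
Proof.
move=> vM [T TM Tx]; have [lam [l0 l1 xE]] := Tx.
exists T, lam; split=> // w; rewrite (interpE _ vM TM Tx) xE bary_comb//.
by have [_ [dM _]] := vM; exact: dM.
Qed.

Lemma simplex_vertex T i : simplex_set T (T i).
Proof.
exists (delta_mx 0 i); split; rewrite ?sum_delta1 ?comb_delta// => j.
by rewrite mxE ler0n.
Qed.

Lemma enorm_sum n (f : 'I_n -> pt) : enorm (\sum_i f i) <= \sum_i enorm (f i).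
Proof.
elim/big_ind2 : _ => [|a x b y ha hb|//]; first by rewrite enorm0.
by rewrite (le_trans (enormD _ _))// lerD.
Qed.

Lemma diam_simplex_ge T i j : enorm (T i - T j) <= diam_simplex T.
Proof.
rewrite /diam_simplex; apply: le_trans (le_bigmax _ _ i).
exact: (le_bigmax _ (fun j => enorm (T i - T j)) j).
Qed.

(** The difference is a convex combination of the edges at [T i]. *)
Lemma vertex_dist M T x i : T \in M -> simplex_set T x ->
  enorm (T i - x) <= meshsize M.
Proof.
move=> TM [lam [l0 l1 ->]].
apply: (@le_trans _ _ (diam_simplex T)); last first.
  exact: (@Order.TotalTheory.le_bigmax_seq _ _ _ M 0 T predT _ TM).
have -> : T i - comb T lam = \sum_j lam 0 j *: (T i - T j).
  rewrite /comb -[in LHS](scale1r (T i)) -l1 scaler_suml -sumrB.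
  by apply: eq_bigr => j _; rewrite scalerBr.
apply: le_trans (enorm_sum _) _.
rewrite -[leRHS]mul1r -l1 mulr_suml; apply: ler_sum => j _.
by rewrite enormZ ger0_norm ?l0// ler_wpM2l ?l0 ?diam_simplex_ge.
Qed.

Lemma meshsize_ge0 M : 0 <= meshsize M.
Proof. exact: bigmax_ge_id. Qed.

(** A displacement [v] changes the weights linearly through the inverse edge matrix, so for small
    [v] the change stays below the least weight [a]. *)
Lemma positive_interior T (lam : 'rV[R]_d.+1) : \det (edge_mx T) != 0 ->
  (forall i, 0 < lam 0 i) -> \sum_i lam 0 i = 1 ->
  interior (simplex_set T) (comb T lam).
Proof.
move=> dT l0 l1; have uT : edge_mx T \in unitmx by rewrite unitmxE unitfE.
pose a := \big[Num.min/1]_i lam 0 i.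
have a0 : 0 < a by rewrite /a; elim/big_ind : _ => // x y x0 y0; rewrite lt_min x0.
have al i : a <= lam 0 i by apply: bigmin_le_cond.
pose B := invmx (edge_mx T); pose C := \sum_i \sum_j `|B j i|.
have C0 : 0 <= C by apply: sumr_ge0 => i _; apply: sumr_ge0.
apply/nbhs_enormP; exists (a / (C + 1)); first by rewrite divr_gt0// ltr_wpDl.
move=> y yx; set v := y - comb T lam in yx; pose nu := v *m B.
have nuC : \sum_i `|nu 0 i| <= a.
  apply: (@le_trans _ _ (enorm v * C)).
    rewrite mulr_sumr; apply: ler_sum => i _; rewrite mxE mulr_sumr.
    apply: le_trans (ler_norm_sum _ _ _) _; apply: ler_sum => j _.
    by rewrite normrM ler_wpM2r// coord_le_enorm.
  move: yx; rewrite ltr_pdivlMr ?ltr_wpDl//.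
  by have := enorm_ge0 v; lra.
have nui i : `|nu 0 i| <= a.
  apply: le_trans nuC; rewrite (bigD1 i)//= lerDl; exact: sumr_ge0.
pose mu : 'rV[R]_d.+1 := \row_i (lam 0 i + oapp (fun j => nu 0 j) (- \sum_j nu 0 j) (unlift ord0 i)).
have mu0 : mu 0 ord0 = lam 0 ord0 - \sum_j nu 0 j by rewrite mxE unlift_none.
have muS j : mu 0 (lift ord0 j) = lam 0 (lift ord0 j) + nu 0 j by rewrite mxE liftK.
have mu1 : \sum_i mu 0 i = 1.
  rewrite big_ord_recl mu0 (eq_bigr _ (fun j _ => muS j)).
  by rewrite big_split /= -l1 [in RHS]big_ord_recl; ring.
exists mu; split=> //.
  move=> i; case: (unliftP ord0 i) => [j ->|->].
    by rewrite muS; have := al (lift ord0 j); have := nui j; rewrite ler_norml; lra.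
  rewrite mu0 subr_ge0; apply: le_trans (al ord0); apply: le_trans nuC.
  by apply: ler_sum => j _; exact: ler_norm.
have -> : y = comb T lam + v by rewrite /v addrC subrK.
rewrite !comb_edge mu1 l1 addrAC; congr (_ + _).
have -> : \row_i mu 0 (lift ord0 i) = \row_i lam 0 (lift ord0 i) + nu.
  by apply/rowP => i; rewrite mxE muS !mxE.
by rewrite mulmxDl /nu mulmxKV.
Qed.

(** Moving a vertex slightly towards the barycentre makes all weights positive and so lands in
    [Omega_h M]. *)
Lemma node_closure M (O : set pt) z : valid_mesh M -> Omega_h M `<=` O ->
  z \in nodes M -> closure O z.
Proof.
move=> [_ [dM _]] hO /nodeP[T [i [TM ->]]]; apply/closureP_enorm => r r0.
pose n1 : R := d.+1%:R; have n0 : 0 < n1 by rewrite ltr0n.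
pose bc : 'rV[R]_d.+1 := const_mx n1^-1.
pose t := Num.min 1 (r / 2 / (1 + enorm (comb T bc - T i))).
have den : 0 < 1 + enorm (comb T bc - T i) by rewrite ltr_pwDl ?enorm_ge0.
have t0 : 0 < t by rewrite lt_min ltr01 !divr_gt0.
have t1 : t <= 1 by rewrite ge_min lexx.
pose lam : 'rV[R]_d.+1 := \row_j ((1 - t) * (delta_mx 0 i : 'rV[R]_d.+1) 0 j + t * n1^-1).
have lam0 j : 0 < lam 0 j.
  rewrite mxE ltr_wpDl ?mulr_gt0 ?invr_gt0//.
  by rewrite mulr_ge0 ?subr_ge0// mxE ler0n.
have lam1 : \sum_j lam 0 j = 1.
  under eq_bigr => j _ do rewrite mxE.
  rewrite big_split /= -mulr_sumr sum_delta1 sumr_const card_ord -mulrnAr.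
  by rewrite -[X in t * X]mulr_natl divff ?gt_eqF//; ring.
have lamE : comb T lam - T i = t *: (comb T bc - T i).
  apply/rowP => k; rewrite !mxE !comb_coord.
  under eq_bigr => j _ do rewrite mxE mulrDl -!mulrA.
  rewrite big_split /= -!mulr_sumr sum_delta.
  under [in RHS]eq_bigr => j _ do rewrite mxE.
  by rewrite -mulr_sumr; ring.
exists (comb T lam); last first.
  rewrite lamE enormZ gtr0_norm//.
  have : t <= r / 2 / (1 + enorm (comb T bc - T i)) by rewrite ge_min lexx orbT.
  rewrite ler_pdivlMr//; lra.
apply: hO; apply: interiorS (positive_interior (dM _ TM) lam0 lam1).
by move=> x Tx; exists T.
Qed.

End Mesh.

(** * Discrete maximum principle *)

Section DiscreteComparison.
Context {R : realType} {d : nat}.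
Set Implicit Arguments. Unset Strict Implicit.
Local Notation pt := 'rV[R]_d.
Variables (M : mesh R d) (eps : R) (S : seq pt).
Implicit Types (w V : pt -> R) (x y z v : pt).

Definition stencil z x : Prop := x = z \/ exists2 v, v \in S & x = z + eps *: v.

Lemma dmax_ge w z x : stencil z x -> interp M w x <= dmax M eps S w z.
Proof.
move=> [->|[v vS ->]]; first exact: bigmax_ge_id.
exact: (@Order.TotalTheory.le_bigmax_seq _ _ _ S _ v predT (fun v => interp M w (z + eps *: v)) vS).
Qed.

Lemma dmin_le w z x : stencil z x -> dmin M eps S w z <= interp M w x.
Proof.
move=> [->|[v vS ->]]; first exact: bigmin_le_id.
rewrite /dmin; elim: S vS => // a s IH; rewrite inE big_cons ge_min.
by case/orP => [/eqP ->|/IH ->]; rewrite ?lexx ?orbT.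
Qed.

Lemma dmax_le w z a : (forall x, stencil z x -> interp M w x <= a) ->
  dmax M eps S w z <= a.
Proof.
move=> h; rewrite /dmax big_seq; apply: bigmax_le; first by apply: h; left.
by move=> v vS; apply: h; right; exists v.
Qed.

Lemma dmin_ge w z a : (forall x, stencil z x -> a <= interp M w x) ->
  a <= dmin M eps S w z.
Proof.
move=> h; rewrite /dmin big_seq; elim/big_ind : _ => [||v vS].
- by apply: h; left.
- by move=> x y ax ay; rewrite le_min ax ay.
- by apply: h; right; exists v.
Qed.

Lemma interpN w x : interp M (fun y => - w y) x = - interp M w x.
Proof. by rewrite /interp -sumrN; apply: eq_bigr => z _; rewrite mulNr. Qed.

Lemma dmaxN w z : dmax M eps S (fun y => - w y) z = - dmin M eps S w z.
Proof.
apply/eqP; rewrite eq_le; apply/andP; split.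
  by apply: dmax_le => x zx; rewrite interpN lerN2 dmin_le.
by rewrite lerNl; apply: dmin_ge => x zx; rewrite lerNl -interpN dmax_ge.
Qed.

Lemma dminN w z : dmin M eps S (fun y => - w y) z = - dmax M eps S w z.
Proof.
have := dmaxN (fun y => - w y) z => /(congr1 -%R); rewrite opprK => <-.
by congr (- dmax _ _ _ _ _); apply/funext => y; rewrite opprK.
Qed.

Lemma neg_dinflapN w z :
  neg_dinflap M eps S (fun y => - w y) z = - neg_dinflap M eps S w z.
Proof. by rewrite /neg_dinflap dmaxN dminN; ring. Qed.

Lemma seq_argmax (T : eqType) (s : seq T) (f : T -> R) : s != [::] ->
  exists2 i, i \in s & forall j, j \in s -> f j <= f i.
Proof.
elim: s => // a [|b s] IH _; first by exists a; rewrite ?mem_head// => j; rewrite inE => /eqP ->.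
have [//|i si hi] := IH; have [ai|ia] := lerP (f a) (f i).
  exists i; first by rewrite inE si orbT.
  by move=> j; rewrite inE => /orP[/eqP -> //|/hi].
exists a; first by rewrite mem_head.
by move=> j; rewrite inE => /orP[/eqP -> //|/hi /le_trans]; apply; exact: ltW.
Qed.

Hypothesis vM : valid_mesh M.

Lemma interp_le w V a x : mesh_union M x ->
  (forall z, z \in nodes M -> w z <= V z + a) -> interp M w x <= interp M V x + a.
Proof.
move=> Mx h; have [T [lam [TM _ l0 l1 E]]] := interp_average vM Mx.
rewrite !E -[a]mul1r -l1 mulr_suml -big_split /=; apply: ler_sum => i _.
by rewrite -mulrDr ler_wpM2l// h// vertex_node.
Qed.

(** At a node of [P] maximizing [V - w], the maximum and minimum of [V] over the stencil exceed
    those of [w] by at most [V - w] there, against the strict inequality. *)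
Lemma discrete_comparison (P : set pt) V w a :
  (forall z x, z \in nodes M -> P z -> stencil z x -> mesh_union M x) ->
  (forall z, z \in nodes M -> P z -> 2 * V z < dmax M eps S V z + dmin M eps S V z) ->
  (forall z, z \in nodes M -> P z -> 2 * w z = dmax M eps S w z + dmin M eps S w z) ->
  (forall z, z \in nodes M -> ~ P z -> V z <= w z + a) ->
  forall z, z \in nodes M -> V z <= w z + a.
Proof.
move=> hM hV hw hb z zM.
have nM : nodes M != [::] by apply: contraTneq zM => ->.
have [z0 z0M hz0] := seq_argmax (fun z => V z - w z) nM.
have [Pz|/(hb _ z0M)] := pselect (P z0); last by have := hz0 _ zM; lra.
pose b := V z0 - w z0.
have hb' y : y \in nodes M -> V y <= w y + b by move=> /hz0; rewrite /b; lra.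
have hmax : dmax M eps S V z0 <= dmax M eps S w z0 + b.
  apply: dmax_le => x zx; apply: le_trans (interp_le (hM _ _ z0M Pz zx) hb') _.
  by rewrite lerD2r dmax_ge.
have hmin : dmin M eps S V z0 - b <= dmin M eps S w z0.
  apply: dmin_ge => x zx; have := interp_le (hM _ _ z0M Pz zx) hb'.
  by have := dmin_le V zx; lra.
have := hV _ z0M Pz; have := hw _ z0M Pz; move: hmax hmin; rewrite /b; lra.
Qed.

End DiscreteComparison.

(** * Strictness from a convex change of values *)

Section Strictness.
Context {R : realType}.
Set Implicit Arguments. Unset Strict Implicit.
Implicit Types (a b t : R).

Definition bend b t : R := t + b * t ^+ 2.

Variables (b K : R).
Hypothesis b_gt0 : 0 < b.
Hypothesis bK : 8 * (b * K) <= 1.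

(** The chord slope [1 + b * (t + s)] lies between 0 and 2. The range reaches [3 * K] because
    [bend_strict] evaluates at a midpoint plus an error of up to [2 * K]. *)
Lemma bend_lip s t : - K <= s -> s <= t -> t <= 3 * K ->
  bend b s <= bend b t /\ bend b t <= bend b s + 2 * (t - s).
Proof.
move=> sK st tK.
have e : bend b t - bend b s = (t - s) * (1 + b * (t + s)) by rewrite /bend; ring.
have K0 : 0 <= K by lra.
have ts : 0 <= t - s by lra.
have h1 : 0 <= 1 + b * (t + s).
  have : b * (- (2 * K)) <= b * (t + s) by rewrite ler_pM2l//; lra.
  have := bK; lra.
have h2 : 1 + b * (t + s) <= 2.
  have : b * (t + s) <= b * (6 * K) by rewrite ler_pM2l//; lra.
  have := bK; lra.
have := mulr_ge0 ts h1; have := ler_wpM2l ts h2; lra.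
Qed.

Lemma bend_close t : `|t| <= K -> t <= bend b t /\ bend b t <= t + b * K ^+ 2.
Proof.
move=> tK; rewrite /bend; have t2 : 0 <= t ^+ 2 by rewrite sqr_ge0.
have t2K : t ^+ 2 <= K ^+ 2.
  rewrite -real_normK ?num_real// ler_pXn2r ?nnegrE//.
  exact: le_trans (normr_ge0 t) tK.
have := mulr_ge0 (ltW b_gt0) t2; have := ler_wpM2l (ltW b_gt0) t2K; lra.
Qed.

(* The gain [b p ^+ 2 / 2] from the curvature of [bend b] beats the loss [3 p q] coming from the defect of [mk] from the midpoint. *)
Lemma bend_strict m0 mk ml q : `|m0| <= K -> `|mk| <= K -> `|ml| <= K ->
  0 < q -> q <= 1 -> 0 < ml - m0 -> 6 * q < b * (ml - m0) ->
  mk <= (m0 + ml) / 2 + (ml - m0) * q ->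
  2 * bend b mk < bend b ml + bend b m0.
Proof.
rewrite !ler_norml => /andP[m0l m0u] /andP[mkl mku] /andP[mll mlu] q0 q1.
set p := ml - m0 => p0 hq hmk.
set c := (m0 + ml) / 2 in hmk; pose e := p * q.
have e0 : 0 < e by rewrite mulr_gt0.
have ep : e <= p by rewrite /e ler_piMr// ltW.
have pK : p <= 2 * K by rewrite /p; lra.
have [||h _] := @bend_lip mk (c + e) _ hmk; rewrite -/e ?/c; try lra.
have cK : `|c| <= K by rewrite ler_norml /c; lra.
have E : bend b ml + bend b m0 = 2 * c + 2 * b * (c ^+ 2 + p ^+ 2 / 4).
  by rewrite /bend /c /p; field.
rewrite E; apply: le_lt_trans (ler_wpM2l _ h) _ => //.
have h3 : 6 * e < b * p ^+ 2.
  have : p * (6 * q) < p * (b * p) by rewrite ltr_pM2l.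
  by rewrite /e; lra.
have h4 : b * (e * (2 * c + e)) <= b * (e * (4 * K)).
  rewrite ler_pM2l// ler_pM2l//; move: cK; rewrite ler_norml; lra.
have h5 : e * (8 * (b * K)) <= e * 1 by rewrite ler_pM2l.
rewrite /bend; lra.
Qed.

End Strictness.

(** * Layers of the domain and the direction net *)

Section Domain.
Context {R : realType} {d : nat}.
Set Implicit Arguments. Unset Strict Implicit.
Variable O : set 'rV[R]_d.
Hypothesis openO : open O.
Implicit Types (x y z : 'rV[R]_d) (r : R).

Lemma dist_bd_le x p : bdry O p -> dist_bd O x <= enorm (x - p).
Proof.
move=> bp; apply: ge_inf; last by exists p.
by exists 0 => _ [q _ <-]; exact: enorm_ge0.
Qed.

Lemma layer_in r x y : layer O r x -> enorm (y - x) <= r -> O y.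
Proof.
move=> [Ox xr] yx; apply: contrapT => nOy.
have [p bp px] := segment_meets_bdry openO Ox nOy.
by have := dist_bd_le x bp; rewrite enormBC; lra.
Qed.

Lemma layer_shift r r' x y : bdry O !=set0 -> layer O (r + r') x -> 0 <= r ->
  enorm (y - x) <= r' -> layer O r y.
Proof.
move=> [p bp] lx r0 yx; split; first by apply: (layer_in lx); lra.
have [_ xr] := lx; have /lt_le_trans -> // : r < dist_bd O x - r' by lra.
apply: lb_le_inf; first by exists (enorm (y - p)), p.
move=> _ [q bq <-]; have := dist_bd_le x bq; have := enormB_triangle y x q.
by rewrite (enormBC x y); lra.
Qed.

Lemma near_bdry r r' z : bdry O !=set0 -> 0 <= r -> r < r' -> closure O z ->
  ~ layer O r z -> exists2 p, bdry O p & enorm (z - p) <= r'.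
Proof.
move=> [p0 bp0] r0 rr' cz nl; have [Oz|nOz] := pselect (O z); last first.
  by exists z; rewrite ?subrr ?enorm0//; lra.
have dr : dist_bd O z <= r by rewrite leNgt; apply/negP => h; exact: nl.
have hi : has_inf [set enorm (z - y) | y in bdry O].
  split; first by exists (enorm (z - p0)), p0.
  by exists 0 => _ [q _ <-]; exact: enorm_ge0.
have e0 : 0 < r' - r by lra.
have [_ [p bp <-] hp] := inf_adherent e0 hi.
by exists p => //; move: hp; rewrite -/(dist_bd O z); lra.
Qed.

(** A segment longer than the domain must leave it. A boundary point makes [dist_bd] a genuine
    infimum instead of a default value. *)
Lemma bounded_bdry (i : 'I_d) B : O !=set0 -> (forall x, O x -> enorm x <= B) ->
  bdry O !=set0.
Proof.
move=> [x Ox] hB; pose y := x + (2 * B + 1) *: evec R i.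
have [|p bp _] := @segment_meets_bdry _ _ O x y openO Ox; last by exists p.
move=> Oy; have := hB _ Ox; have := hB _ Oy.
have := coord_le_enorm y i; have := coord_le_enorm x i.
by rewrite !ler_norml /y !mxE !eqxx mulr1; lra.
Qed.

Lemma holder_le (A : set 'rV[R]_d) alpha K r (f : 'rV[R]_d -> R) x y :
  0 <= alpha -> 0 <= K -> holder_bound A alpha K f -> A x -> A y ->
  enorm (x - y) <= r -> `|f x - f y| <= K * powR r alpha.
Proof.
move=> a0 K0 [_ h] Ax Ay xy; apply: le_trans (h _ _ Ax Ay) _.
apply: ler_wpM2l => //; apply: ge0_ler_powR; rewrite ?nnegrE ?enorm_ge0//.
exact: le_trans (enorm_ge0 _) xy.
Qed.

(** Beyond radius [eps], replacing the direction of [y - z] by one of the net costs at most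
    [eps * theta], and the remaining radial distance at most [eps - eps * theta]. *)
Lemma net_covering theta S eps z y : 0 < eps -> sphere_net theta S ->
  enorm (y - z) <= 2 * eps - eps * theta ->
  exists2 x, stencil eps S z x & enorm (x - y) <= eps.
Proof.
move=> e0 [_ _ net] yz; have [h|h] := lerP (enorm (y - z)) eps.
  by exists z; [left|rewrite enormBC].
have rho0 : 0 < enorm (y - z) by lra.
set rho := enorm (y - z) in yz h rho0.
pose v := rho^-1 *: (y - z).
have v1 : enorm v = 1.
  by rewrite /v enormZ gtr0_norm ?invr_gt0// mulVf// gt_eqF.
have yE : y - z = rho *: v by rewrite /v scalerA divff ?gt_eqF// scale1r.
clearbody v; have [w wS vw] := net v v1; exists (z + eps *: w); first by right; exists w.
have -> : z + eps *: w - y = - (eps *: (v - w) + (rho - eps) *: v).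
  apply/rowP => i; have /rowP/(_ i) := yE; rewrite !mxE; lra.
rewrite enormN (le_trans (enormD _ _))// !enormZ v1 gtr0_norm// gtr0_norm; last lra.
have : eps * enorm (v - w) <= eps * theta by rewrite ler_pM2l.
lra.
Qed.

End Domain.

(** * The one-sided error bound *)

Section OneSided.
Context {R : realType} {d : nat}.
Set Implicit Arguments. Unset Strict Implicit.
Implicit Types (x y z : 'rV[R]_d) (O : set 'rV[R]_d).

Lemma nat_multiple (a s : R) : 0 <= a -> 0 < s ->
  exists n : nat, n%:R * s <= a /\ a < n.+1%:R * s.
Proof.
move=> a0 s0; exists (Num.truncn (a / s)).
have /andP[h1 h2] := truncn_itv (divr_ge0 a0 (ltW s0)).
by rewrite -ler_pdivlMr// h1 -ltr_pdivrMr.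
Qed.

Lemma steep_subsolution O (i : 'I_d) (B K s c : R) (u : 'rV[R]_d -> R) (N : nat) :
  (forall x, O x -> enorm x <= B) -> (forall x, O x -> `|u x| <= K) ->
  {within closure O, continuous u} -> cone_above O u -> 0 < s -> 0 < c ->
  2 * B < N%:R * s ->
  exists F : 'rV[R]_d -> R,
    (forall x, ball_sup O u s x - 2 * (N%:R * c) <= F x <= ball_sup O u s x) /\
    forall x (t : R), deep O s x -> 0 < t -> exists y, [/\ near_step O s x y,
      F x + c - t <= F y &
      forall y', near_step O s x y' -> 2 * F x <= F y + F y' + t].
Proof.
move=> OB uK cu ca s0 c0 BN; pose v := ball_sup O u s.
have step x : deep O s x -> exists2 y, near_step O s x y & forall y', near_step O s x y' ->
    v y' <= v y /\ 2 * v x <= v y + v y'.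
  exact: (ball_sup_step s0 uK cu ca).
have ex x : exits (near_step O s) (deep O s) N x.
  apply: (exits_bounded s0 (i := i) (B := B)).
    by move=> y Oy; have := coord_le_enorm y i; have := OB y Oy; rewrite ler_norml; lra.
  by move=> Ox; have := coord_le_enorm x i; have := OB x Ox; rewrite ler_norml; lra.
exists (steepen (near_step O s) (deep O s) v c); split=> [x|x t dx t0].
  by rewrite (steepen_ge c0 step ex) (steepen_le c0 step ex).
exact: (steepen_step c0 (@near_step_sym _ _ O s) step ex).
Qed.

(** The radius [k%:R * s] exceeds half of [L] by at most [eta]; the chord bound turns this into a
    relative defect [eta / L]. *)
Lemma midpoint_defect (k l : nat) (s L eta m0 mk ml : R) : (0 < l)%N -> 0 < s ->
  L = l%:R * s -> 2 * (k%:R * s) - L <= 2 * eta -> 0 <= ml - m0 ->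
  l%:R * (mk - m0) <= k%:R * (ml - m0) ->
  mk <= (m0 + ml) / 2 + (ml - m0) * (eta / L).
Proof.
move=> l0 s0 LE hk p0 h; have L0 : 0 < L by rewrite LE mulr_gt0 ?ltr0n.
have h1 : L * (mk - m0) <= (k%:R * s) * (ml - m0).
  have := ler_wpM2l (ltW s0) h; rewrite LE; lra.
have h2 : (ml - m0) * (2 * (k%:R * s)) <= (ml - m0) * (L + 2 * eta).
  by apply: ler_wpM2l => //; lra.
have e : (ml - m0) * (L * (eta / L)) = (ml - m0) * eta.
  by rewrite (mulrC L) divfK// gt_eqF.
by rewrite -(ler_pM2l L0); lra.
Qed.

Variables (O : set 'rV[R]_d) (alpha K B : R).
Hypothesis d_gt0 : (0 < d)%N.
Hypothesis openO : open O.
Hypothesis O_neq0 : O !=set0.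
Hypothesis OB : forall x, O x -> enorm x <= B.
Hypothesis alpha01 : 0 < alpha <= 1.
Hypothesis K_gt0 : 0 < K.

(** A bound for [F]: the steepening lowers values by at most [2 * (2 * B + 1)] when [gam <= 1]. *)
Let K1 : R := K + 4 * B + 5.

Variables (M : mesh R d) (eps theta : R) (S : seq 'rV[R]_d).
Let h := meshsize M.
Let eta := 2 * h + eps * theta.
(** The factor 3 yields [9 * eta] in [gam_sqr], more than the [6 * eta] asked by [bend_strict]. *)
Let gam := 3 * (Num.sqrt eta / eps).
Hypothesis vM : valid_mesh M.
Hypothesis layerM : layer O h `<=` Omega_h M.
Hypothesis OmegaM : Omega_h M `<=` O.
Hypothesis h_le : h <= eps.
Hypothesis eps_le1 : eps <= 1.
Hypothesis theta01 : 0 < theta <= 1.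
Hypothesis netS : sphere_net theta S.
Hypothesis gap : 0 < eps - eps * theta - h.
Hypothesis small : 8 * (gam * K1) <= 1.

Variables g gt u uh : 'rV[R]_d -> R.
Hypothesis gtK : holder_bound (closure O) alpha K gt.
Hypothesis ggt : forall x, bdry O x -> `|g x - gt x| <= K * powR eps alpha.
Hypothesis ug : forall x, bdry O x -> u x = g x.
Hypothesis cu : {within closure O, continuous u}.
Hypothesis uK : holder_bound (closure O) alpha K u.
Hypothesis ca : cone_above O u.
Hypothesis uhV : in_Vh M uh.
Hypothesis uh_int : forall z, interior_node O M eps z -> neg_dinflap M eps S uh z = 0.
Hypothesis uh_bd : forall z, z \in nodes M -> ~ interior_node O M eps z -> uh z = gt z.

Lemma B_ge0 : 0 <= B.
Proof. by have [x /OB] := O_neq0; exact: le_trans (enorm_ge0 x). Qed.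

Lemma h_ge0 : 0 <= h. Proof. exact: meshsize_ge0. Qed.

Lemma eps_gt0 : 0 < eps.
Proof.
have [t0 t1] := andP theta01; have h0 := h_ge0; have hg := gap.
rewrite ltNge; apply/negP => e0; have : eps = 0 by apply/le_anti/andP; split=> //; exact: le_trans h0 h_le.
by move=> ee; move: hg; rewrite ee mul0r; lra.
Qed.

Lemma eps_theta_gt0 : 0 < eps * theta.
Proof. by have [t0 _] := andP theta01; rewrite mulr_gt0 ?eps_gt0. Qed.

Lemma eta_gt0 : 0 < eta.
Proof. by have := eps_theta_gt0; have := h_ge0; rewrite /eta; lra. Qed.

Lemma gam_gt0 : 0 < gam.
Proof. by rewrite mulr_gt0// divr_gt0 ?eps_gt0// sqrtr_gt0 eta_gt0. Qed.

Lemma gam_sqr : gam ^+ 2 * eps ^+ 2 = 9 * eta.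
Proof.
rewrite /gam -exprMn -mulrA divfK ?gt_eqF ?eps_gt0// exprMn sqr_sqrtr ?(ltW eta_gt0)//.
by rewrite -natrX.
Qed.

Lemma K1_ge5 : 5 <= K1.
Proof. by have := B_ge0; have := K_gt0; rewrite /K1; lra. Qed.

Lemma gam_le1 : gam <= 1.
Proof.
have h1 := small; have h2 : gam * 1 <= gam * K1.
  by rewrite ler_pM2l ?gam_gt0//; have := K1_ge5; lra.
have := gam_gt0; lra.
Qed.

Lemma pow3 (r : R) : 0 <= r -> powR (3 * r) alpha <= 3 * powR r alpha.
Proof.
move=> r0; have [a0 a1] := andP alpha01; rewrite powRM//.
apply: ler_wpM2r; first exact: powR_ge0.
by rewrite -[leRHS](powRr1 (a := 3))//; apply: ler_powR => //; rewrite ler1n.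
Qed.

Lemma osc (f : 'rV[R]_d -> R) r x y : holder_bound (closure O) alpha K f ->
  closure O x -> closure O y -> enorm (x - y) <= r -> `|f x - f y| <= K * powR r alpha.
Proof.
have [a0 _] := andP alpha01; move=> fK Ox Oy xy.
exact: (holder_le (ltW a0) (ltW K_gt0) fK).
Qed.

Lemma osc3 (f : 'rV[R]_d -> R) x y : holder_bound (closure O) alpha K f ->
  closure O x -> closure O y -> enorm (x - y) <= 3 * eps ->
  `|f x - f y| <= 3 * (K * powR eps alpha).
Proof.
move=> fK Ox Oy xy; apply: le_trans (osc fK Ox Oy xy) _.
by rewrite mulrCA ler_pM2l// pow3// ltW// eps_gt0.
Qed.

Lemma bdryO_neq0 : bdry O !=set0.
Proof. exact: (bounded_bdry openO (Ordinal d_gt0) O_neq0 OB). Qed.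

(** A boundary point lies within [3 * eps]; the oscillations of [u] and [gt] count 3 each, the
    mismatch of [g] and [gt] counts 1. *)
Lemma boundary_node_close z : z \in nodes M -> ~ layer O (2 * eps) z ->
  u z <= gt z + 7 * (K * powR eps alpha).
Proof.
move=> zM nl; have e0 := eps_gt0; have cz := node_closure vM OmegaM zM.
have [||p bp zp] := near_bdry bdryO_neq0 _ _ cz nl (r' := 3 * eps); try lra.
have cp : closure O p by case: bp.
have := osc3 uK cz cp zp; have := osc3 gtK cz cp zp; have := ggt bp.
by rewrite (ug bp) !ler_norml; lra.
Qed.

Lemma stencil_layer z x : interior_node O M eps z -> stencil eps S z x ->
  mesh_union M x /\ enorm (x - z) <= eps.
Proof.
move=> [zM zl] [->|[v vS ->]].
  split; last by rewrite subrr enorm0 ltW ?eps_gt0.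
  by have [T [i [TM ->]]] := nodeP zM; exists T => //; exact: simplex_vertex.
have v1 : enorm v = 1 by have [h1 _ _] := netS; exact: h1.
have xz : enorm (z + eps *: v - z) <= eps.
  by rewrite addrC addKr enormZ v1 gtr0_norm ?eps_gt0// mulr1.
split=> //; apply: interior_subset; apply: layerM.
have e0 := eps_gt0; have [|Ox dx] := layer_shift openO (r := eps) (r' := eps) bdryO_neq0 _ (ltW e0) xz.
  by rewrite (_ : eps + eps = 2 * eps); [exact: zl|ring].
by split=> //; apply: le_lt_trans h_le dx.
Qed.

(* The step [s] divides [eps + h] exactly, and is at most [eps theta / 2] so that the rounding of [2 eps - eps theta] to [l s] costs at most [eta]. *)
Lemma scales : exists (s : R) (k l N : nat), [/\ 0 < s, 2 * s <= eps * theta,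
  k%:R * s = eps + h, (k <= l)%N & (0 < l)%N] /\
  [/\ l%:R * s <= 2 * eps - eps * theta, 2 * eps - eps * theta < l%:R * s + s,
   2 * B < N%:R * s & N%:R * s <= 2 * B + 1].
Proof.
have e0 := eps_gt0; have et := eps_theta_gt0; have h0 := h_ge0; have B0 := B_ge0.
have hg := gap; have e1 := eps_le1; have [t0 t1] := andP theta01.
have et1 : eps * theta <= eps * 1 by rewrite ler_pM2l.
have a0 : 0 <= eps + h by lra.
have b0 : 0 < eps * theta / 2 by lra.
have [n [n1 n2]] := nat_multiple a0 b0.
have k0 : 0 < (n.+1%:R : R) by rewrite ltr0n.
pose s := (eps + h) / n.+1%:R.
have s0 : 0 < s by rewrite divr_gt0//; lra.
have sE : n.+1%:R * s = eps + h by rewrite mulrC divfK// gt_eqF.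
have st : 2 * s <= eps * theta.
  have : s <= eps * theta / 2 by rewrite ler_pdivrMr// mulrC ltW.
  lra.
have c0 : 0 <= 2 * eps - eps * theta by lra.
have d0 : 0 <= 2 * B by lra.
have [l [l1 l2]] := nat_multiple c0 s0; have [N [N1 N2]] := nat_multiple d0 s0.
(* By [gap], [eps + h] is less than [2 * eps - eps * theta], hence than [l.+1%:R * s]. *)
have kl : (n.+1 < l.+1)%N by rewrite -(ltr_nat R) -(ltr_pM2r s0) sE; lra.
exists s, n.+1, l, N.+1; split; split=> //.
- by case: l kl {l1 l2}.
- by move: l2; rewrite -natr1; lra.
- rewrite -natr1; lra.
Qed.

Lemma one_sided_bound x : Omega_h M x ->
  u x - uh x <= 12 * (K * powR eps alpha) + 2 * (gam * K1 ^+ 2) + 2 * (gam * (2 * B + 1)).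
Proof.
move=> Mx; have e0 := eps_gt0; have g0 := gam_gt0; have B0 := B_ge0; have h0 := h_ge0.
have he := h_le; have e1 := eps_le1; have et0 := eps_theta_gt0.
have K0 := K_gt0; have K15 := K1_ge5.
have [s [k [l [N [[s0 st ks kl l0] [ls1 ls2 N1 N2]]]]]] := scales.
have et1 : eps * theta <= eps by have [_ t1] := andP theta01; rewrite ler_piMr// ltW.
pose c := gam * s; have c0 : 0 < c by rewrite mulr_gt0.
have uKO y : O y -> `|u y| <= K by move=> Oy; apply: (proj1 uK); exact: subset_closure.
have [F [Fv Fstep]] := steep_subsolution (Ordinal d_gt0) OB uKO cu ca s0 c0 N1.
have Nc : N%:R * c <= gam * (2 * B + 1) by rewrite mulrCA ler_pM2l.
have gB : gam * (2 * B + 1) <= 2 * B + 1 by rewrite ler_piMl ?gam_le1//; lra.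
have FK y : O y -> `|F y| <= K1.
  move=> Oy; have := ball_sup_bound uKO (r := s) (x := y).
  have yy : exists2 w, O w & enorm (w - y) <= s.
    by exists y; rewrite ?subrr ?enorm0 ?ltW.
  by move=> /(_ yy); have /andP[] := Fv y; rewrite /K1 !ler_norml; lra.
(* The radius adds the mesh size to [eps], so that [W] at every vertex around a point within [eps]
   of [y] dominates [F y]. *)
pose W := ball_sup O F (eps + h).
pose V y := bend gam (W y).
have WF y z : O y -> enorm (y - z) <= eps + h -> F y <= W z by exact: (ball_sup_ge FK).
have WK z : closure O z -> `|W z| <= K1.
  move=> /closureP_enorm/(_ _ e0)[y Oy yz]; apply: ball_sup_bound => //.
  by exists y => //; lra.
have nodeO z : z \in nodes M -> closure O z by exact: (node_closure vM OmegaM).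
have Kp : 0 <= K * powR eps alpha by rewrite mulr_ge0 ?powR_ge0// ltW.
have interpV y z : mesh_union M z -> O y -> enorm (z - y) <= eps ->
    bend gam (F y) <= interp M V z.
  move=> Mz Oy zy; have [T [lam [TM Tz l0' l1 E]]] := interp_average vM Mz.
  rewrite E -[leLHS]mul1r -l1 mulr_suml; apply: ler_sum => i _.
  apply: ler_wpM2l => //; have := WK _ (nodeO _ (vertex_node i TM)).
  have : F y <= W (T i).
    apply: WF => //; have := enormB_triangle z y (T i); rewrite (enormBC y z) (enormBC z (T i)).
    have := vertex_dist i TM Tz; rewrite -/h; lra.
  move=> FW; have := FK _ Oy; rewrite !ler_norml => /andP[F1 F2] /andP[W1 W2].
  by have [] := bend_lip g0 small F1 FW _; first lra.
have strict z : z \in nodes M -> interior_node O M eps z ->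
    2 * V z < dmax M eps S V z + dmin M eps S V z.
  move=> zM iz; have [_ lz] := iz; have Oz : O z by case: lz.
  (* The two extra steps fit because [2 * s <= eps * theta]. *)
  have ball_in y : enorm (y - z) <= l.+2%:R * s -> O y.
    move=> yz; apply: (layer_in openO lz).
    by move: yz; rewrite -[l.+2]addn2 natrD; lra.
  have [hr hs] := ball_sup_radial s0 FK Fstep ball_in kl.
  pose L := l%:R * s; set ml := ball_sup O F (l%:R * s) z in hr hs.
  have mlK : `|ml| <= K1.
    apply: ball_sup_bound => //; exists z; rewrite ?subrr ?enorm0//.
    by rewrite mulr_ge0// ltW.
  rewrite ks in hr.
  have Leps : eps + h <= L by rewrite -ks /L ler_pM2r// ler_nat.
  have L0 : 0 < L by lra.
  have gL : gam * L <= ml - F z by move: hs; rewrite /c /L; lra.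
  have gL0 : 0 < gam * L by rewrite mulr_gt0.
  have etaL : eta <= L.
    have := gam_sqr; have : gam ^+ 2 * eps ^+ 2 <= 1 * (eps * 1).
      apply: ler_pM; rewrite ?exprn_ge0 ?(ltW g0) ?(ltW e0)//.
        by rewrite expr2 mulr_ile1 ?gam_le1// ltW.
      by rewrite expr2 ler_wpM2l// ltW.
    by have := eta_gt0; lra.
  have q0 : 0 < eta / L by rewrite divr_gt0 ?eta_gt0.
  have q1 : eta / L <= 1 by rewrite ler_pdivrMr// mul1r.
  have hW : W z <= (F z + ml) / 2 + (ml - F z) * (eta / L).
    apply: (midpoint_defect (k := k) l0 s0) => //; rewrite ?ks//; last by lra.
    by rewrite /eta /L; lra.
  have hq : 6 * (eta / L) < gam * (ml - F z).
    apply: (@lt_le_trans _ _ (gam * (gam * L))); last by rewrite ler_pM2l.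
    rewrite mulrA ltr_pdivrMr//.
    apply: (@lt_le_trans _ _ (gam ^+ 2 * eps ^+ 2)); first by rewrite gam_sqr; have := eta_gt0; lra.
    have -> : gam * (gam * L) * L = gam ^+ 2 * L ^+ 2 by ring.
    rewrite ler_pM2l ?exprn_gt0//.
    by rewrite ler_pXn2r ?nnegrE ?(ltW e0) ?(ltW L0)//; lra.
  apply: lt_le_trans (bend_strict g0 small (FK _ Oz) (WK _ (nodeO _ zM)) mlK q0 q1 _ hq hW) _.
    by lra.
  (* The minimum dominates [bend gam (F z)] since stencil points are within [eps] of [z]. The
     maximum dominates [bend gam ml] since, by [net_covering], each point of the ball defining [ml]
     is within [eps] of a stencil point. *)
  apply: lerD; last first.
    apply: dmin_ge => y zy; have [My yz] := stencil_layer iz zy.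
    exact: interpV.
  (* Half of [t] suffices, as [bend] has slope at most 2 on the range. *)
  apply/ler_addgt0Pr => t t0; have t20 : 0 < t / 2 by lra.
  have hsup : has_sup [set F y | y in [set y | O y /\ enorm (y - z) <= l%:R * s]].
    split; first by exists (F z), z => //=; rewrite subrr enorm0 ltW.
    by exists K1 => _ [y [Oy _] <-]; exact: le_trans (ler_norm _) (FK _ Oy).
  have [_ [y [Oy yz] <-]] := sup_adherent t20 hsup.
  rewrite -/(ball_sup O F (l%:R * s) z) -/ml => Fy.
  have [p zp py] := net_covering e0 netS (le_trans yz ls1).
  have [Mp _] := stencil_layer iz zp.
  have h1 := interpV _ _ Mp Oy py; have h2 := dmax_ge M V zp.
  have Fml : F y <= ml by exact: (ball_sup_ge FK).
  move: (FK _ Oy) mlK; rewrite !ler_norml => /andP[F1 _] /andP[_ m1].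
  have [|_] := bend_lip g0 small F1 Fml; lra.
(* Seven multiples come from [boundary_node_close], three from [W] against [u], and the last term
   from [bend]. *)
pose a := 10 * (K * powR eps alpha) + gam * K1 ^+ 2.
have compare z : z \in nodes M -> V z <= uh z + a.
  apply: (discrete_comparison (S := S) (eps := eps) vM (P := interior_node O M eps)) => //.
  - by move=> z' y _ iz /(stencil_layer iz)[].
  - move=> z' _ /uh_int /eqP; rewrite mulf_eq0 invr_eq0 expf_eq0 gt_eqF//= => /eqP.
    lra.
  move=> z' zM nz; rewrite (uh_bd zM nz).
  have nl : ~ layer O (2 * eps) z' by move=> lz; apply: nz.
  have h1 := boundary_node_close zM nl; have cz := nodeO _ zM.
  have h2 : W z' <= u z' + 3 * (K * powR eps alpha).
    apply: ball_sup_le; first by have [y Oy yz] := (proj1 (closureP_enorm _ _)) cz _ e0; exists y => //; lra.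
    move=> y Oy yz; have /andP[_ /le_trans] := Fv y; apply.
    apply: ball_sup_le; first by exists y; rewrite ?subrr ?enorm0 ?ltW.
    move=> w Ow wy; have : enorm (w - z') <= 3 * eps.
      by have := enormB_triangle y w z'; lra.
    by move=> /(osc3 uK (subset_closure Ow) cz); rewrite ler_norml; lra.
  by have [_] := bend_close g0 (WK _ cz); rewrite -/(V z') /a; lra.
(* A node may lie on the boundary, so [u z] is first compared with [u y] at a nearby [y] in [O];
   this is the eleventh multiple, and the last term is the loss by steepening. *)
have node_bound z : z \in nodes M -> u z <= uh z + 11 * (K * powR eps alpha)
    + 2 * (gam * K1 ^+ 2) + 2 * (gam * (2 * B + 1)).
  move=> zM; have cz := nodeO _ zM.
  have [y Oy yz] := (proj1 (closureP_enorm _ _)) cz _ s0.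
  have zy : enorm (z - y) <= eps by rewrite enormBC; lra.
  have := osc uK cz (subset_closure Oy) zy; rewrite ler_norml => /andP[_ h1].
  have h2 : u y <= ball_sup O u s y by apply: (ball_sup_ge uKO Oy); rewrite subrr enorm0 ltW.
  have /andP[h3 _] := Fv y.
  have h4 : F y <= W z by apply: WF => //; lra.
  have [h5 _] := bend_close g0 (WK _ cz).
  have g1 : 0 <= gam * K1 ^+ 2 by rewrite mulr_ge0 ?sqr_ge0 ?ltW.
  by have := compare _ zM; rewrite /a /V; lra.
have cx : closure O x by apply: subset_closure; exact: OmegaM.
have [T [lam [TM Tx l0' l1 E]]] := interp_average vM (interior_subset Mx).
have uhx : uh x = interp M uh x by apply: uhV; exact: interior_subset.
set D := (X in _ <= X).
(* As the weights sum to 1, [u x] is bounded vertex by vertex; the oscillation of [u] over the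
   simplex is the twelfth multiple. *)
suff : \sum_i lam 0 i * u x <= \sum_i (lam 0 i * D + lam 0 i * uh (T i)).
  by rewrite uhx E big_split /= -!mulr_suml l1; lra.
apply: ler_sum => i _; rewrite -mulrDr; apply: ler_wpM2l => //.
have xT : enorm (x - T i) <= eps.
  by rewrite enormBC; apply: le_trans (vertex_dist i TM Tx) he.
have := osc uK cx (nodeO _ (vertex_node i TM)) xT; rewrite ler_norml.
have := node_bound _ (vertex_node i TM); rewrite /D; lra.
Qed.

End OneSided.

(** * Choice of constants and the two one-sided bounds *)

Theorem theorem4p3 (R : realType) (d : nat) (Omega : set 'rV[R]_d)
    (sig alpha K : R) :
  (0 < d)%N -> bounded_domain Omega -> continuous_boundary Omega ->
  0 < sig -> 0 < alpha <= 1 -> 0 < K ->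
  exists C delta : R, 0 < C /\ 0 < delta /\
  forall (M : mesh R d) (eps theta : R) (S : seq 'rV[R]_d)
         (g gt u uh : 'rV[R]_d -> R),
    valid_mesh M -> quasiuniform sig M ->
    layer Omega (meshsize M) `<=` Omega_h M -> Omega_h M `<=` Omega ->
    meshsize M <= eps <= diam_set Omega -> 0 < theta <= 1 ->
    sphere_net theta S ->
    (* (BC.1) + g in C^{0,alpha}(bdry Omega) *)
    holder_bound (bdry Omega) alpha K g ->
    (* (BC.2): tilde g_eps in C^{0,alpha}(closure Omega), close to g on the boundary *)
    holder_bound (closure Omega) alpha K gt ->
    (forall x, bdry Omega x -> `|g x - gt x| <= K * powR eps alpha) ->
    (* u : viscosity solution with f = 0, u in C^{0,alpha}(closure Omega) *)
    visc_sol Omega (fun _ => 0) g u ->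
    holder_bound (closure Omega) alpha K u ->
    (* (M.1) *)
    cond_M1 Omega M eps S ->
    (* discretization parameters sufficiently small *)
    meshsize M <= delta -> eps <= delta -> theta <= delta ->
    0 < eps - eps * theta - meshsize M ->
    (2 * meshsize M + eps * theta) / eps ^+ 2 <= delta ->
    discrete_sol Omega M eps S gt uh ->
    forall x, Omega_h M x ->
      `|u x - uh x| <= C * (powR eps alpha + Num.sqrt (2 * meshsize M + eps * theta) / eps).
Proof.
move=> d0 [oO [_ [nO [B OB]]]] _ sig0 a01 K0.
have B0 : 0 <= B by have [x /OB] := nO; exact: le_trans (enorm_ge0 x).
pose K1 : R := K + 4 * B + 5; have K10 : 0 < 24 * K1 by rewrite /K1; lra.
have i0 : 0 < (24 * K1)^-1 by rewrite invr_gt0.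
have i1 : (24 * K1)^-1 <= 1 by rewrite invf_le1// /K1; lra.
(* The coefficients are those of [one_sided_bound], where [gam] is three times the square root term.
   The threshold is a square since it bounds the square of that term, and [24 * K1] produces
   [small]. *)
exists (12 * K + 6 * K1 ^+ 2 + 6 * (2 * B + 1)), ((24 * K1)^-1 ^+ 2).
split; first by have := sqr_ge0 K1; lra.
split; first by rewrite exprn_gt0.
move=> M eps theta S g gt u uh vM _ lM OM /andP[he _] t01 netS _ gtK ggt vs uK _ _.
move=> epsd _ gap kap [uhV uh_int uh_bd] x Mx.
have [cu ug _] := vs.
have e1 : eps <= 1 by apply: le_trans epsd _; rewrite exprn_ile1// ltW.
pose q := Num.sqrt (2 * meshsize M + eps * theta) / eps.
have e0 := eps_gt0 he t01 gap.
have q0 : 0 <= q by rewrite divr_ge0 ?sqrtr_ge0// ltW.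
have qi : q <= (24 * K1)^-1.
  have hs : 2 * meshsize M + eps * theta <= ((24 * K1)^-1 * eps) ^+ 2.
    by rewrite exprMn -ler_pdivrMr// exprn_gt0.
  have := ler_wsqrtr hs; rewrite sqrtr_sqr ger0_norm; last by rewrite mulr_ge0 ?ltW.
  by rewrite /q ler_pdivrMr.
have small : 8 * (3 * q * K1) <= 1.
  have : q * (24 * K1) <= 1 by rewrite -ler_pdivlMr// mul1r.
  lra.
(* Stated for generic data so as to apply to [u], [uh] and to their negatives. *)
have final v gv gtv vh : holder_bound (closure Omega) alpha K gtv ->
    (forall x, bdry Omega x -> `|gv x - gtv x| <= K * powR eps alpha) ->
    (forall x, bdry Omega x -> v x = gv x) ->
    {within closure Omega, continuous v} -> holder_bound (closure Omega) alpha K v ->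
    radial_subsolution Omega v -> in_Vh M vh ->
    (forall z, interior_node Omega M eps z -> neg_dinflap M eps S vh z = 0) ->
    (forall z, z \in nodes M -> ~ interior_node Omega M eps z -> vh z = gtv z) ->
    v x - vh x <= (12 * K + 6 * K1 ^+ 2 + 6 * (2 * B + 1)) * (powR eps alpha + q).
  move=> gtvK gtvg vg cv vK rv vhV vhi vhb.
  have ca := radial_cone_above cv rv.
  have := one_sided_bound d0 oO nO OB a01 K0 vM lM OM he e1 t01 netS gap small
    gtvK gtvg vg cv vK ca vhV vhi vhb Mx.
  rewrite -/q -/K1; have p0 := powR_ge0 eps alpha.
  have := mulr_ge0 (ltW K0) q0; have := mulr_ge0 (sqr_ge0 K1) p0.
  have := mulr_ge0 B0 p0; lra.
have holderN f : holder_bound (closure Omega) alpha K f ->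
    holder_bound (closure Omega) alpha K (fun y => - f y).
  by move=> [f1 f2]; split=> [y Ay|y z Ay Az]; rewrite -?opprD normrN; [exact: f1|exact: f2].
rewrite -/q ler_norml; apply/andP; split; last first.
  exact: final gtK ggt ug cu uK (visc_sol_radial vs) uhV uh_int uh_bd.
suff h : - u x - - uh x <= (12 * K + 6 * K1 ^+ 2 + 6 * (2 * B + 1)) * (powR eps alpha + q).
  by move: h; lra.
apply: (final (fun y => - u y) (fun y => - g y) (fun y => - gt y) (fun y => - uh y)).
- exact: holderN.
- by move=> y by_; rewrite -opprD normrN; exact: ggt.
- by move=> y /ug ->.
- by move=> y; apply: (@continuousN R R^o); exact: cu.
- exact: holderN.
- exact: visc_sol_radialN vs.
- by move=> y My; rewrite interpN -uhV.
- by move=> z /uh_int; rewrite neg_dinflapN => ->; rewrite oppr0.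
- by move=> z zM /(uh_bd z zM) ->.
Qed.
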